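(* Let $G$ be a four-dimensional real Lie group admitting a left-invariant symplectic structure, with Lie algebra $\mathfrak{g}$. Then $G$ admits a left-invariant almost-Kähler structure with non-degenerate Ricci curvature if and only if $\mathfrak{g}$ is not isomorphic to $\mathfrak{h}_3\times\mathbb{R}$, to $\mathfrak{aff}(\mathbb{R})\times\mathbb{R}^2$, or to the four-dimensional abelian Lie algebra. The same equivalence holds with ''non-degenerate Ricci curvature'' replaced by ''non-degenerate Ricci curvature of signature $(+,-,-,-)$''.
   Context: A left-invariant almost-Kähler structure on $G$ is a triple $(g,\omega,J)$ of a left-invariant Riemannian metric $g$, a left-invariant symplectic form $\omega$ and a left-invariant almost-complex structure $J$ with $\omega(\cdot,\cdot')=g(J\cdot,\cdot')$. Its Ricci curvature is the Ricci tensor of $g$, with the usual convention $\mathrm{Ric}(y,z)=\mathrm{trace}(x\mapsto R(x,y)z)$, $R(x,y)=[\nabla_x,\nabla_y]-\nabla_{[x,y]}$, regarded as a symmetric bilinear form on $\mathfrak{g}$; signature $(+,-,-,-)$ means one positive and three negative eigenvalues, irrespective of order. $\mathfrak{h}_3$ is the 3-dimensional Heisenberg Lie algebra, and $\mathfrak{aff}(\mathbb{R})$ is the 2-dimensional non-abelian Lie algebra of the group of affine motions of $\mathbb{R}$. *)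

(* Defs.v *)
From HB Require Import structures.
From mathcomp Require Import all_boot all_order all_algebra.
From mathcomp Require Import reals ring.

Set Implicit Arguments.
Unset Strict Implicit.
Unset Printing Implicit Defensive.

Import Order.TTheory GRing.Theory Num.Theory.
Local Open Scope ring_scope.

(* A left-invariant tensor field (or affine connection) on a Lie group G is the
   same thing as a multilinear map on its Lie algebra, obtained by evaluating
   on left-invariant vector fields.  All geometric structures below are
   therefore given on the Lie algebra, and covariant derivatives and exterior
   differentials are those of left-invariant fields and forms. *)

HB.mixin Record Vector_isLieAlgebra (R : fieldType) V of Vector R V := {
  lie : V -> V -> V;
  lie_bilinear : bilinear_for *:%R *:%R lie;
  liexx : forall x, lie x x = 0;
  lie_jacobi : forall x y z,
    lie x (lie y z) + lie y (lie z x) + lie z (lie x y) = 0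
}.

#[short(type="lieAlgType")]
HB.structure Definition LieAlgebra (R : fieldType) :=
  { V of Vector_isLieAlgebra R V & Vector R V }.

HB.instance Definition _ (R : fieldType) (L : lieAlgType R) :=
  bilinear_isBilinear.Build R L L L *:%R *:%R (@lie R L) lie_bilinear.

Definition lie_isomorphic (R : fieldType) (L M : lieAlgType R) : Prop :=
  exists2 f : 'Hom(L, M), bijective f & forall x y, f (lie x y) = lie (f x) (f y).

Section LieProduct.
Context {R : fieldType} {L M : lieAlgType R}.

Definition prod_lie (x y : L * M) : L * M := (lie x.1 y.1, lie x.2 y.2).

Lemma prod_lie_bilinear : bilinear_for *:%R *:%R prod_lie.
Proof.
by split=> u a x y; congr pair; rewrite /= ?linearPl ?linearPr.
Qed.

Lemma prod_liexx x : prod_lie x x = 0.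
Proof. by rewrite /prod_lie !liexx. Qed.

Lemma prod_lie_jacobi x y z :
  prod_lie x (prod_lie y z) + prod_lie y (prod_lie z x)
    + prod_lie z (prod_lie x y) = 0.
Proof. by congr pair; exact: lie_jacobi. Qed.

HB.instance Definition _ := Vector_isLieAlgebra.Build R (L * M)%type
  prod_lie_bilinear prod_liexx prod_lie_jacobi.
End LieProduct.

Definition abelian_lie (R : fieldType) (n : nat) : Type := 'rV[R]_n.
HB.instance Definition _ (R : fieldType) n := Vector.on (abelian_lie R n).

Section Abelian.
Context {R : fieldType} {n : nat}.

Definition zero_lie (x y : 'rV[R]_n) : 'rV[R]_n := 0.

Lemma zero_lie_bilinear : bilinear_for *:%R *:%R zero_lie.
Proof. by split=> u a x y; rewrite /= /zero_lie scaler0 addr0. Qed.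

Lemma zero_liexx x : zero_lie x x = 0. Proof. by []. Qed.

Lemma zero_lie_jacobi x y z :
  zero_lie x (zero_lie y z) + zero_lie y (zero_lie z x)
    + zero_lie z (zero_lie x y) = 0.
Proof. by rewrite /zero_lie !addr0. Qed.

HB.instance Definition _ := Vector_isLieAlgebra.Build R (abelian_lie R n)
  zero_lie_bilinear zero_liexx zero_lie_jacobi.
End Abelian.

(* Basis e_0, e_1, e_2 with [e_0, e_1] = e_2 as only nonzero basic bracket. *)
Definition heis3 (R : fieldType) : Type := 'rV[R]_3.
HB.instance Definition _ (R : fieldType) := Vector.on (heis3 R).

Section Heisenberg.
Context {R : fieldType}.

Definition heis3_lie (x y : 'rV[R]_3) : 'rV[R]_3 :=
  (x 0 0 * y 0 1 - x 0 1 * y 0 0) *: delta_mx 0 2.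

Lemma heis3_lie_bilinear : bilinear_for *:%R *:%R heis3_lie.
Proof.
by split=> u a x y; rewrite /= /heis3_lie scalerA -scalerDl !mxE; congr (_ *: _); ring.
Qed.

Lemma heis3_liexx x : heis3_lie x x = 0.
Proof. by rewrite /heis3_lie mulrC subrr scale0r. Qed.

Lemma heis3_lie_jacobi x y z :
  heis3_lie x (heis3_lie y z) + heis3_lie y (heis3_lie z x)
    + heis3_lie z (heis3_lie x y) = 0.
Proof. by rewrite /heis3_lie !mxE /= !mulr0 !subr0 !scale0r !addr0. Qed.

HB.instance Definition _ := Vector_isLieAlgebra.Build R (heis3 R)
  heis3_lie_bilinear heis3_liexx heis3_lie_jacobi.
End Heisenberg.

(* e_0 generates the dilations and e_1 the translations: [e_0, e_1] = e_1. *)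
Definition aff1 (R : fieldType) : Type := 'rV[R]_2.
HB.instance Definition _ (R : fieldType) := Vector.on (aff1 R).

Section Affine.
Context {R : fieldType}.

Definition aff1_lie (x y : 'rV[R]_2) : 'rV[R]_2 :=
  (x 0 0 * y 0 1 - x 0 1 * y 0 0) *: delta_mx 0 1.

Lemma aff1_lie_bilinear : bilinear_for *:%R *:%R aff1_lie.
Proof.
by split=> u a x y; rewrite /= /aff1_lie scalerA -scalerDl !mxE; congr (_ *: _); ring.
Qed.

Lemma aff1_liexx x : aff1_lie x x = 0.
Proof. by rewrite /aff1_lie mulrC subrr scale0r. Qed.

Lemma aff1_lie_jacobi x y z :
  aff1_lie x (aff1_lie y z) + aff1_lie y (aff1_lie z x)
    + aff1_lie z (aff1_lie x y) = 0.
Proof.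
rewrite /aff1_lie !mxE /= -!scalerDl -[RHS](scale0r (delta_mx 0 1)).
by congr (_ *: _); ring.
Qed.

HB.instance Definition _ := Vector_isLieAlgebra.Build R (aff1 R)
  aff1_lie_bilinear aff1_liexx aff1_lie_jacobi.
End Affine.

Section LeftInvariantGeometry.
Context {R : realType} {L : lieAlgType R}.

Definition nondegenerate_form (B : L -> L -> R) : Prop :=
  forall x, (forall y, B x y = 0) -> x = 0.

(* d w (x, y, z) = - w([x, y], z) - w([y, z], x) - w([z, x], y) *)
Definition closed_form (w : L -> L -> R) : Prop :=
  forall x y z, w (lie x y) z + w (lie y z) x + w (lie z x) y = 0.

Definition is_symplectic_form (w : {skew_symmetric L}) : Prop :=
  nondegenerate_form w /\ closed_form w.

Definition is_almost_kahler (g : {dot L for idfun}) (w : {skew_symmetric L})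
    (J : 'End(L)) : Prop :=
  [/\ is_symplectic_form w,
      forall x, J (J x) = - x
    & forall x y, w x y = g (J x) y].

(* On left-invariant fields g(y, z) is constant, so metric compatibility has no
   derivative term. *)
Definition is_levi_civita (g : {dot L for idfun})
    (nabla : {bilinear L -> L -> L}) : Prop :=
  (forall x y, nabla x y - nabla y x = lie x y) /\
  (forall x y z, g (nabla x y) z + g y (nabla x z) = 0).

Section LeviCivita.
Variable g : {dot L for idfun}.
Let e := vbasis {:L}.

Lemma metric_sym x y : g x y = g y x.
Proof. by rewrite (hermitian_subproof x y) expr0 mul1r. Qed.

Let gPl a x y z : g (a *: x + y) z = a * g x z + g y z.
Proof. by rewrite linearPl. Qed.

Let gPr a x y z : g z (a *: x + y) = a * g z x + g z y.
Proof. by rewrite !(metric_sym z) gPl. Qed.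

Let gBl x y z : g (x - y) z = g x z - g y z.
Proof. by rewrite addrC -scaleN1r gPl mulN1r addrC. Qed.

Let g0l z : g 0 z = 0.
Proof. by rewrite -(subrr 0) gBl subrr. Qed.

Let gNl x z : g (- x) z = - g x z.
Proof. by rewrite -sub0r gBl g0l sub0r. Qed.

Let gsl (I : finType) (c : I -> R) (v : I -> L) z :
  g (\sum_i c i *: v i) z = \sum_i c i * g (v i) z.
Proof.
apply: (big_ind2 (fun x a => g x z = a)) => [|x a y b <- <-|i _].
- exact: g0l.
- by rewrite -[x in LHS]scale1r gPl mul1r.
- by rewrite -[X in g X _]addr0 gPl g0l addr0.
Qed.

Lemma metric_inj x y : (forall z, g x z = g y z) -> x = y.
Proof.
move=> gxy; apply/eqP; rewrite -subr_eq0; apply/negPn/negP => /(@neq0_dnorm_gt0 _ _ _ g).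
by rewrite gBl gxy subrr ltxx.
Qed.

Let gram := \matrix_(i < \dim {:L}, j < \dim {:L}) g e`_i e`_j.

Let gram_unit : gram \in unitmx.
Proof.
rewrite -row_free_unit -kermx_eq0; apply/rowV0P => c /sub_kermxP c0.
suff ce0 : \sum_(i < \dim {:L}) c 0 i *: e`_i = 0.
  apply/rowP => i; rewrite mxE.
  by have /freeP/(_ _ ce0) := basis_free (vbasisP {:L}).
apply: metric_inj => z; rewrite g0l metric_sym [z](coord_vbasis (memvf z)) gsl.
apply: big1 => j _; rewrite metric_sym gsl.
have := congr1 (fun M : 'rV_ _ => M 0 j) c0; rewrite !mxE => cj.
rewrite (_ : \sum_i _ = 0) ?mulr0 // -[RHS]cj.
by apply: eq_bigr => i _; rewrite mxE.
Qed.

Let liePl a (x y z : L) : lie (a *: x + y) z = a *: lie x z + lie y z.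
Proof. exact: (@lie_bilinear R L).1. Qed.

Let liePr a (x y z : L) : lie z (a *: x + y) = a *: lie z x + lie z y.
Proof. exact: (@lie_bilinear R L).2. Qed.

(* The Koszul formula, without derivative terms. *)
Let koszul (x y z : L) : R := 2^-1 * (g (lie x y) z - g (lie y z) x + g (lie z x) y).

Let lc x y : L :=
  \sum_(i < \dim {:L}) (\row_(k < \dim {:L}) koszul x y e`_k *m invmx gram) 0 i *: e`_i.

Let koszulP a x y u v : koszul x y (a *: u + v) = a * koszul x y u + koszul x y v.
Proof. by rewrite /koszul liePl liePr !gPl gPr; ring. Qed.

Let koszul_sum (I : finType) x y (c : I -> R) (v : I -> L) :
  koszul x y (\sum_i c i *: v i) = \sum_i c i * koszul x y (v i).
Proof.
have k0 : koszul x y 0 = 0.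
  have /(congr1 (fun t => t - koszul x y 0)) := koszulP 1 x y 0 0.
  by rewrite scale1r addr0 mul1r addrK subrr.
apply: (big_ind2 (fun u a => koszul x y u = a)) => [|u a w b <- <-|i _].
- exact: k0.
- by rewrite -[u in LHS]scale1r koszulP mul1r.
- by rewrite -[X in koszul _ _ X]addr0 koszulP k0 addr0.
Qed.

Let lcP x y z : g (lc x y) z = koszul x y z.
Proof.
rewrite metric_sym [z](coord_vbasis (memvf z)) gsl koszul_sum.
apply: eq_bigr => j _; congr (_ * _); rewrite metric_sym gsl.
have := mulmxKV gram_unit (\row_(k < \dim {:L}) koszul x y e`_k).
move=> /(congr1 (fun M : 'rV_ _ => M 0 j)).
by rewrite mxE [RHS]mxE => <-; apply: eq_bigr => i _; rewrite [gram _ _]mxE.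
Qed.

Let lieC (x y : L) : lie x y = - lie y x.
Proof.
apply/eqP; rewrite -addr_eq0; have := liexx (x + y).
by rewrite linearDl !linearDr /= !liexx add0r addr0 => ->.
Qed.

Let lc_bilinear : bilinear_for *:%R *:%R lc.
Proof.
by split=> u a x y; apply: metric_inj => z /=;
  rewrite gPl !lcP /koszul ?liePl ?liePr !gPl ?gPr; ring.
Qed.

Lemma levi_civita_exists : exists nabla, is_levi_civita g nabla.
Proof.
pose lcB := bilinear_isBilinear.Build R L L L *:%R *:%R lc lc_bilinear.
pose nabla : {bilinear L -> L -> L} := HB.pack lc lcB.
exists nabla; split=> [x y|x y z]; rewrite /nabla /=.
  apply: metric_inj => z; rewrite gBl !lcP /koszul.
  by rewrite (lieC y x) (lieC z x) (lieC z y) !gNl; field.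
rewrite (metric_sym y) !lcP /koszul.
by rewrite (lieC y x) (lieC z x) (lieC z y) !gNl; field.
Qed.

Lemma levi_civita_unique nabla nabla' :
  is_levi_civita g nabla -> is_levi_civita g nabla' -> nabla =2 nabla'.
Proof.
suff k (n : {bilinear L -> L -> L}) x y z :
    is_levi_civita g n -> g (n x y) z = koszul x y z.
  by move=> n1 n2 x y; apply: metric_inj => z; rewrite !k.
case=> tor met; rewrite /koszul -!tor !gBl.
have {}met u v w : g (n u v) w = - g (n u w) v.
  by apply/eqP; rewrite -addr_eq0 (metric_sym (n u w)) met.
by rewrite (met x z) (met y x) (met z y); field.
Qed.

End LeviCivita.

Definition curvature (nabla : L -> L -> L) (x y z : L) : L :=
  nabla x (nabla y z) - nabla y (nabla x z) - nabla (lie x y) z.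

Definition lin_trace (f : L -> L) : R :=
  let e := vbasis {:L} in \sum_i coord e i (f e`_i).

Definition ricci (nabla : L -> L -> L) (y z : L) : R :=
  lin_trace (fun x => curvature nabla x y z).

(* s lists, with multiplicity, the eigenvalues of the bilinear form B relative
   to the metric g, i.e. those of the endomorphism A with g (A x) y = B x y. *)
Definition eigenvalues_of_form (g : {dot L for idfun}) (B : L -> L -> R)
    (s : seq R) : Prop :=
  exists2 A : 'End(L), forall x y, g (A x) y = B x y
    & char_poly (passmx.mxof (vbasis {:L}) (vbasis {:L}) A)
      = \prod_(a <- s) ('X - a%:P).

Definition has_signature (g : {dot L for idfun}) (B : L -> L -> R)
    (p q : nat) : Prop :=
  exists2 s, eigenvalues_of_form g B s
    & [/\ size s = (p + q)%N, count (> 0) s = p & count (< 0) s = q].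

End LeftInvariantGeometry.

(* Main.v *)
Require Import Defs.
From HB Require Import structures.
From mathcomp Require Import all_boot all_order all_algebra.
From mathcomp Require Import reals boolp ring lra polyrcf.

(* For a symplectic form w put T(x, y, z) = w([x, y], z), let v_x be the vector
   with w(v_x, _) = T(x, _, x), and let N(x) = T(x, v_x, v_x).

   If N(x) <> 0 for some x, then v_x and x are the first and last vectors of a
   Darboux frame e_0, ..., e_3 (w = e^01 + e^23) that can be rescaled so that its
   brackets tend to those of the filiform algebra [e_3, e_0] = A e_1,
   [e_3, e_1] = B e_2, with B^2 > 2 A^2.  In the limit the Ricci tensor of the
   metric making the frame orthonormal is diagonal with four distinct
   eigenvalues, three negative and one positive, and this persists nearby.

   If N vanishes identically for every symplectic form, then the coefficients of
   N and the Jacobi identity leave, besides the abelian algebra, three families.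
   Two of them are single algebras with an explicit solution (the algebra of the
   complex hyperbolic plane and r_{4,-1,-1}).  On the third one, adding to w a
   product of two closed 1-forms makes N nonzero, unless the algebra is excluded.

   Conversely, an excluded algebra has a two-dimensional central subspace and a
   derived algebra of dimension at most one, so for every metric some central
   vector z <> 0 is orthogonal to the derived algebra.  Such a z is parallel,
   hence Ric(z, _) = 0. *)

Set Implicit Arguments.
Unset Strict Implicit.
Unset Printing Implicit Defensive.

Import Order.TTheory GRing.Theory Num.Theory.
Local Open Scope ring_scope.

(** * Sums over four indices and coordinates in a frame of four vectors *)

Lemma sum4 (V : nmodType) (F : nat -> V) :
  \sum_(i < 4) F i = F 0%N + F 1%N + F 2%N + F 3%N.
Proof. by rewrite !big_ord_recr big_ord0 /= add0r. Qed.

Lemma sum_ord4 (V : nmodType) (F : 'I_4 -> V) :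
  \sum_i F i = F (inord 0) + F (inord 1) + F (inord 2) + F (inord 3).
Proof.
have -> : \sum_i F i = \sum_(i < 4) F (inord i).
  by apply: eq_bigr => i _; rewrite inord_val.
exact: (sum4 (F \o inord)).
Qed.

Section Coordinates.
Context {R : fieldType} {L : lieAlgType R}.

Lemma lieC (x y : L) : lie x y = - lie y x.
Proof.
apply/eqP; rewrite -addr_eq0; have := liexx (x + y).
by rewrite linearDl !linearDr /= !liexx add0r addr0 => ->.
Qed.

Definition structure_constants (X : 4.-tuple L) (c : nat -> nat -> nat -> R) :=
  forall i j : 'I_4, lie X`_i X`_j = \sum_(k < 4) c i j k *: X`_k.

Lemma coord_inj n (X : n.-tuple L) x y :
  basis_of fullv X -> (forall i, coord X i x = coord X i y) -> x = y.
Proof.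
move=> XB xy; rewrite (coord_basis XB (memvf x)) (coord_basis XB (memvf y)).
by apply: eq_bigr => i _; rewrite xy.
Qed.

Lemma coord_nth n (X : n.-tuple L) (i : 'I_n) (k : nat) :
  basis_of fullv X -> (k < n)%N -> coord X i X`_k = (i == k :> nat)%:R.
Proof.
move=> XB kn; rewrite -[k]/(nat_of_ord (Ordinal kn)).
by rewrite coord_free ?(basis_free XB) // eq_sym.
Qed.

Definition vec4 (X : 4.-tuple L) (a b c d : R) : L :=
  a *: X`_0 + b *: X`_1 + c *: X`_2 + d *: X`_3.

Lemma vec4_linear X k a b c d a' b' c' d' :
  k *: vec4 X a b c d + vec4 X a' b' c' d'
    = vec4 X (k * a + a') (k * b + b') (k * c + c') (k * d + d').
Proof.
have E p q r s : vec4 X p q r s = \sum_(j < 4) [:: p; q; r; s]`_j *: X`_j.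
  by rewrite (sum4 (fun j => [:: p; q; r; s]`_j *: X`_j)).
rewrite !E scaler_sumr -big_split /=; apply: eq_bigr => -[[|[|[|[|]]]] //= _] _;
  by rewrite scalerA -scalerDl.
Qed.

Lemma vec4_coord (X : 4.-tuple L) x : basis_of fullv X ->
  x = vec4 X (coord X (inord 0) x) (coord X (inord 1) x)
             (coord X (inord 2) x) (coord X (inord 3) x).
Proof.
by move=> XB; rewrite {1}(coord_basis XB (memvf x)) sum_ord4 /vec4 !inordK.
Qed.

Lemma coord_vec4 (X : 4.-tuple L) a b c d : basis_of fullv X ->
  [/\ coord X (inord 0) (vec4 X a b c d) = a,
      coord X (inord 1) (vec4 X a b c d) = b,
      coord X (inord 2) (vec4 X a b c d) = c
    & coord X (inord 3) (vec4 X a b c d) = d].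
Proof.
move=> XB; have E i : coord X i (vec4 X a b c d) = nth 0 [:: a; b; c; d] i.
  have -> : vec4 X a b c d = \sum_(j < 4) [:: a; b; c; d]`_j *: X`_j.
    by rewrite (sum4 (fun j => [:: a; b; c; d]`_j *: X`_j)).
  by rewrite coord_sum_free ?(basis_free XB).
by rewrite !E !inordK.
Qed.

End Coordinates.

(** * The metric, two-form and rotation for which a frame is orthonormal and Darboux *)

Section StandardStructure.
Context {R : realType} {L : lieAlgType R}.
Variable X : 4.-tuple L.
Hypothesis XB : basis_of fullv X.

Local Notation "x `# i" := (coord X (inord i) x) (at level 2, left associativity).

Definition std_metric (x y : L) : R := \sum_i coord X i x * coord X i y.

Definition std_form (x y : L) : R :=
  x`#0 * y`#1 - x`#1 * y`#0 + x`#2 * y`#3 - x`#3 * y`#2.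

Lemma std_metric_bilinear : bilinear_for *%R (idfun \; *%R) std_metric.
Proof.
by split=> u a x y; rewrite /std_metric /= mulr_sumr -big_split /=;
  apply: eq_bigr => i _; rewrite linearP /=; ring.
Qed.

Lemma std_metric_sym x y : std_metric x y = (-1) ^+ false * idfun (std_metric y x).
Proof. by rewrite expr0 mul1r; apply: eq_bigr => i _; rewrite mulrC. Qed.

Lemma std_metric_pos x : x != 0 -> 0 < std_metric x x.
Proof.
move=> x0; rewrite lt_neqAle sumr_ge0 ?andbT; last by move=> i _; exact: sqr_ge0.
apply: contra_neq x0 => /esym/psumr_eq0P c0.
rewrite (coord_basis XB (memvf x)) big1 // => i _.
have /eqP := c0 (fun i _ => sqr_ge0 _) i isT.
by rewrite mulf_eq0 orbb => /eqP ->; rewrite scale0r.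
Qed.

Lemma std_form_bilinear : bilinear_for *%R (idfun \; *%R) std_form.
Proof. by split=> u a x y; rewrite /std_form /= !linearP /=; ring. Qed.

Lemma std_form_skew x y : std_form x y = (-1) ^+ true * idfun (std_form y x).
Proof. by rewrite /std_form /=; ring. Qed.

Definition std_dot : {dot L for idfun} :=
  HB.pack std_metric
    (bilinear_isBilinear.Build R L L R *%R (idfun \; *%R) std_metric std_metric_bilinear)
    (isHermitianSesquilinear.Build R L false idfun std_metric std_metric_sym)
    (isDotProduct.Build R L std_metric std_metric_pos).

Definition std_skew : {skew_symmetric L} :=
  HB.pack std_form
    (bilinear_isBilinear.Build R L L R *%R (idfun \; *%R) std_form std_form_bilinear)
    (isHermitianSesquilinear.Build R L true idfun std_form std_form_skew).

Definition std_rotation (x : L) : L := vec4 X (- x`#1) x`#0 (- x`#3) x`#2.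

Lemma std_rotation_linear : linear std_rotation.
Proof.
by move=> a x y; rewrite /std_rotation vec4_linear !linearP /=; congr vec4; ring.
Qed.

HB.instance Definition _ := GRing.isLinear.Build R L L *:%R std_rotation
  std_rotation_linear.

End StandardStructure.

(** * Traces in an arbitrary basis and the Koszul formula *)

Section LinTrace.
Context {R : realType} {L : lieAlgType R}.

(** Basis independence of the trace: the vectors of [vbasis] are expanded in [X], and exchanging the
    two sums recovers the expansion of each image in [vbasis]. *)
Lemma lin_trace_basis n (X : n.-tuple L) (f : L -> L) :
  basis_of fullv X -> linear f -> lin_trace f = \sum_i coord X i (f X`_i).
Proof.
move=> XB flin.
have fsum (I : finType) (k : I -> R) (v : I -> L) :
    f (\sum_i k i *: v i) = \sum_i k i *: f (v i).
  have f0 : f 0 = 0.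
    have /(congr1 (fun t => t - f 0)) := flin 1 0 0.
    by rewrite !scale1r addr0 addrK subrr.
  apply: (big_ind2 (fun u w => f u = w)) => [|u u' w w' <- <-|i _]; first exact: f0.
    by rewrite -[u in LHS]scale1r flin scale1r.
  by rewrite -[X in f X]addr0 flin f0 addr0.
rewrite /lin_trace.
under eq_bigr => i _ do
  rewrite [X in f X](coord_basis XB (memvf _)) fsum linear_sum.
rewrite exchange_big /=; apply: eq_bigr => j _.
rewrite [X in coord X j]/= [f X`_j in RHS](coord_vbasis (memvf _)) linear_sum /=.
by apply: eq_bigr => i _; rewrite !linearZ /= mulrC.
Qed.

(** Torsion-freeness turns each bracket into a difference of covariant derivatives; metric
    compatibility then cancels everything but two copies of [g (n x y) z]. *)
Lemma koszul_formula (g : {dot L for idfun}) (n : {bilinear L -> L -> L}) x y z :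
  is_levi_civita g n ->
  g (n x y) z = 2^-1 * (g (lie x y) z - g (lie y z) x + g (lie z x) y).
Proof.
case=> tor met; rewrite -!tor.
have gB u v w : g (u - v) w = g u w - g v w.
  by rewrite addrC -scaleN1r linearPl /= mulN1r addrC.
have {}met u v w : g (n u v) w = - g (n u w) v.
  by apply/eqP; rewrite -addr_eq0 (metric_sym g (n u w)) met.
by rewrite !gB (met x z) (met y x) (met z y); field.
Qed.

End LinTrace.

(** * The Ricci tensor of an orthonormal frame from its structure constants *)

Section RicciMatrix.
Context {K : comNzRingType}.
Implicit Type c : nat -> nat -> nat -> K.

(* Twice the Christoffel symbols and four times the Ricci tensor of an orthonormal
   frame; clearing denominators lets [K] be a polynomial ring. *)
Definition christoffel2 c i j k : K := c i j k - c j k i + c k i j.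

Definition ricci4 c j k : K :=
  \sum_(i < 4) \sum_(m < 4)
    (christoffel2 c j k m * christoffel2 c i m i
     - christoffel2 c i k m * christoffel2 c j m i
     - c i j m * christoffel2 c m k i *+ 2).

Definition ricci4_mx c : 'M[K]_4 := \matrix_(j, k) ricci4 c j k.

End RicciMatrix.

Section RicciOfBasis.
Context {R : realType} {L : lieAlgType R}.
Variables (X : 4.-tuple L) (XB : basis_of fullv X).
Variables (c : nat -> nat -> nat -> R) (cX : structure_constants X c).
Variable nabla : {bilinear L -> L -> L}.
Hypothesis nablaP : is_levi_civita (std_dot XB) nabla.

Lemma coordX (i j : 'I_4) : coord X i X`_j = (i == j)%:R.
Proof. by rewrite eq_sym coord_free ?(basis_free XB). Qed.

Lemma std_metric_basis x (i : 'I_4) : std_metric X x X`_i = coord X i x.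
Proof.
rewrite /std_metric (bigD1 i) //= coordX eqxx mulr1 big1 ?addr0 // => j ji.
by rewrite coordX (negPf ji) mulr0.
Qed.

Lemma coord_lie (i j k : 'I_4) : coord X k (lie X`_i X`_j) = c i j k.
Proof.
rewrite cX linear_sum (bigD1 k) //= linearZ /= coordX eqxx mulr1 big1 ?addr0 //.
by move=> m mk; rewrite linearZ /= coordX eq_sym (negPf mk) mulr0.
Qed.

Lemma nabla_basis (i j : 'I_4) :
  nabla X`_i X`_j = \sum_(k < 4) (2^-1 * christoffel2 c i j k) *: X`_k.
Proof.
rewrite [LHS](coord_basis XB (memvf _)); apply: eq_bigr => k _; congr (_ *: _).
rewrite -std_metric_basis [LHS](koszul_formula _ _ _ nablaP).
by rewrite /std_dot /= !std_metric_basis !coord_lie.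
Qed.

Lemma ricci_basis (j k : 'I_4) :
  ricci nabla X`_j X`_k = 4^-1 * ricci4 c j k.
Proof.
rewrite /ricci (lin_trace_basis XB); last first.
  move=> a x y; apply: (coord_inj XB) => i.
  by rewrite /curvature !(linearPl, linearP, linearB, linearD, linearN, linearZ) /=; ring.
rewrite /ricci4 mulr_sumr; apply: eq_bigr => i _.
rewrite /curvature !linearB /= cX (nabla_basis j k) (nabla_basis i k).
rewrite !linear_sumr linear_sumlz !linear_sum /= -!sumrB mulr_sumr.
apply: eq_bigr => m _.
rewrite !linearZr_LR linearZl_LR !linearZ /= !nabla_basis !linear_sum /=.
have pick (F : nat -> R) : \sum_(l < 4) coord X i (F l *: X`_l) = F i.
  rewrite (bigD1 i) //= linearZ /= coordX eqxx mulr1 big1 ?addr0 // => l li.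
  by rewrite linearZ /= coordX eq_sym (negPf li) mulr0.
by rewrite !(pick (fun l => 2^-1 * christoffel2 c _ _ l)); field.
Qed.

End RicciOfBasis.

(** * Characteristic polynomials and the location of their roots *)

Section CharPoly.

Lemma horner_char_poly (K : comNzRingType) n (A : 'M[K]_n) a :
  (char_poly A).[a] = \det (a%:M - A).
Proof.
rewrite /char_poly -horner_evalE -det_map_mx; congr (\det _).
by apply/matrixP => i j; rewrite !mxE /= /horner_eval !hornerE hornerMn hornerX.
Qed.

Lemma char_poly_conj (K : fieldType) n (P Q A : 'M[K]_n) :
  P *m Q = 1%:M -> char_poly (P *m A *m Q) = char_poly A.
Proof.
move=> PQ; have QP := mulmx1C PQ; rewrite /char_poly.
have -> : char_poly_mx (P *m A *m Q) =
    map_mx polyC P *m char_poly_mx A *m map_mx polyC Q.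
  rewrite /char_poly_mx mulmxBr mulmxBl -!map_mxM; congr (_ - _).
  by rewrite scalar_mxC -mulmxA -map_mxM PQ map_mx1 mulmx1.
rewrite !det_mulmx mulrC mulrA -det_mulmx -map_mxM QP map_mx1 det1 mul1r.
by [].
Qed.

(** [eigenvalues_of_form] refers to [vbasis], whereas the Ricci tensor is computed in an adapted
    frame; the two matrices are conjugate by the change of basis. *)
Lemma char_poly_basis (K : fieldType) (V : vectType K) n (X : n.-tuple V)
    (A : 'End(V)) : basis_of fullv X ->
  char_poly (passmx.mxof (vbasis {:V}) (vbasis {:V}) A)
    = char_poly (\matrix_(i < n, j < n) coord X j (A X`_i)).
Proof.
move=> XB; have e : n = \dim {:V} by rewrite (size_basis XB).
move: X XB; subst n => X XB; have vB := vbasisP {:V}.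
have -> : \matrix_(i, j) coord X j (A X`_i) = passmx.mxof X X A.
  by apply/matrixP => i j; rewrite !mxE /= passmx.vecof_delta.
have XX : passmx.mxof X (vbasis {:V}) \1%VF *m passmx.mxof (vbasis {:V}) X \1%VF = 1%:M.
  rewrite -passmx.mxof_comp // comp_lfun1l; apply/matrixP => i j.
  by rewrite !mxE /= passmx.vecof_delta lfunE /= coord_free ?(basis_free XB).
rewrite -[in RHS](comp_lfun1l A) -[in RHS](comp_lfun1r (\1 \o A)%VF).
by rewrite (passmx.mxof_comp _ _ vB) // (passmx.mxof_comp _ _ vB) // mulmxA char_poly_conj.
Qed.

(** Each sign change yields a root inside an open interval; four distinct roots exhaust a monic
    polynomial of degree four. *)
Lemma four_roots (R : rcfType) (p : {poly R}) (a0 a1 a2 a3 a4 : R) :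
    p \is monic -> size p = 5%N ->
    a0 < a1 -> a1 < a2 -> a2 < a3 -> a3 < a4 ->
    0 < p.[a0] -> p.[a1] < 0 -> 0 < p.[a2] -> p.[a3] < 0 -> 0 < p.[a4] ->
  exists x0 x1 x2 x3, [/\ p = \prod_(x <- [:: x0; x1; x2; x3]) ('X - x%:P),
     x0 < a1, x1 < a2, x2 < a3 & a3 < x3].
Proof.
move=> pm ps a01 a12 a23 a34 p0 p1 p2 p3 p4.
have ivt (q : {poly R}) a b : a < b -> q.[a] < 0 -> 0 < q.[b] ->
    exists2 x, a < x < b & root q x.
  move=> ab qa qb; have [||x /andP[ax xb] qx] := @poly_ivt _ q a b; first exact: ltW.
    by rewrite !ltW.
  exists x => //; rewrite !lt_neqAle ax xb !andbT.
  apply/andP; split; first by apply: contraTneq qa => ->; rewrite (rootP qx) ltxx.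
  by apply: contraTneq qb => <-; rewrite (rootP qx) ltxx.
have ivtN a b : a < b -> 0 < p.[a] -> p.[b] < 0 -> exists2 x, a < x < b & root p x.
  move=> ab pa pb; have [||x xab] := ivt (- p) a b ab; rewrite ?hornerN ?oppr_lt0 ?oppr_gt0 //.
  by rewrite rootN; exists x.
have [x0 /andP[a0x0 x0a1] r0] := ivtN _ _ a01 p0 p1.
have [x1 /andP[a1x1 x1a2] r1] := ivt _ _ _ a12 p1 p2.
have [x2 /andP[a2x2 x2a3] r2] := ivtN _ _ a23 p2 p3.
have [x3 /andP[a3x3 x3a4] r3] := ivt _ _ _ a34 p3 p4.
exists x0, x1, x2, x3; split=> //.
have := @all_roots_prod_XsubC _ p [:: x0; x1; x2; x3].
rewrite (eqP (pm : lead_coef p == 1)) scale1r; apply => //.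
- by rewrite /= r0 r1 r2 r3.
have x01 := lt_trans x0a1 a1x1; have x12 := lt_trans x1a2 a2x2.
have x23 := lt_trans x2a3 a3x3.
rewrite uniq_rootsE /= !inE !negb_or (lt_eqF x01) (lt_eqF x12) (lt_eqF x23).
by rewrite (lt_eqF (lt_trans x01 x12)) (lt_eqF (lt_trans x12 x23))
  (lt_eqF (lt_trans x01 (lt_trans x12 x23))).
Qed.

End CharPoly.

(** * Signature (1, 3) from signs of the characteristic polynomial *)

Definition admits_ricci13 (R : realType) (L : lieAlgType R) : Prop :=
  exists (g : {dot L for idfun}) (w : {skew_symmetric L}) (J : 'End(L))
         (nabla : {bilinear L -> L -> L}),
    [/\ is_almost_kahler g w J, is_levi_civita g nabla,
        nondegenerate_form (ricci nabla)
      & has_signature g (ricci nabla) 1 3].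

Section AlmostKahlerOfBasis.
Context {R : realType} {L : lieAlgType R}.

Variables (X : 4.-tuple L) (XB : basis_of fullv X).
Variables (c : nat -> nat -> nat -> R) (cX : structure_constants X c).

Local Notation "x `# i" := (coord X (inord i) x) (at level 2, left associativity).

Lemma std_form_rotation x y : std_form X x y = std_metric X (std_rotation X x) y.
Proof.
rewrite /std_metric sum_ord4 /std_rotation /std_form.
by case: (coord_vec4 (- x`#1) x`#0 (- x`#3) x`#2 XB) => -> -> -> ->; ring.
Qed.

Lemma std_rotationK x : std_rotation X (std_rotation X x) = - x.
Proof.
rewrite [in RHS](vec4_coord x XB) {1}/std_rotation /std_rotation.
case: (coord_vec4 (- x`#1) x`#0 (- x`#3) x`#2 XB) => -> -> -> ->.
by rewrite /vec4 !opprD !scaleNr.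
Qed.

(** If [w x] vanishes, then g(Jx, Jx) = w(x, Jx) = 0, so Jx = 0 and x = - J(Jx) = 0. *)
Lemma std_form_nondegenerate : nondegenerate_form (std_form X).
Proof.
move=> x wx0; apply/eqP; rewrite -[x]opprK oppr_eq0 -std_rotationK.
suff /eqP-> : std_rotation X x == 0 by rewrite linear0.
by apply/negPn/negP => /(std_metric_pos XB); rewrite -std_form_rotation wx0 ltxx.
Qed.

(** The alternating signs isolate three negative eigenvalues and a positive one; the nonzero value
    at 0 also rules out a kernel of the Ricci tensor. *)
Lemma ricci13_of_signs (a0 a1 a2 a4 : R)
    (chi := fun a : R => \det (a%:M - ricci4_mx c)) :
  closed_form (std_form X) ->
  a0 < a1 -> a1 < a2 -> a2 < 0 -> 0 < a4 ->
  0 < chi a0 -> chi a1 < 0 -> 0 < chi a2 -> chi 0 < 0 -> 0 < chi a4 ->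
  admits_ricci13 L.
Proof.
move=> wcl a01 a12 a20 a04 chi0 chi1 chi2 chi3 chi4.
have [nabla nablaP] := levi_civita_exists (std_dot XB).
have ric (j k : 'I_4) := ricci_basis cX nablaP j k.
(* As [X] is orthonormal, this is the Ricci endomorphism, g(Ax, y) = Ric(x, y). *)
pose A x := \sum_(k < 4) ricci nabla x X`_k *: X`_k.
have ricP y a x x' : ricci nabla (a *: x + x') y = a * ricci nabla x y + ricci nabla x' y.
  rewrite /ricci /lin_trace mulr_sumr -big_split; apply: eq_bigr => i _ /=.
  by rewrite /curvature !(linearPl, linearP, linearB, linearPr) /= ; ring.
have ricPr y a x x' : ricci nabla y (a *: x + x') = a * ricci nabla y x + ricci nabla y x'.
  rewrite /ricci /lin_trace mulr_sumr -big_split; apply: eq_bigr => i _ /=.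
  by rewrite /curvature !(linearPr, linearP, linearB) /=; ring.
have Alin : linear A.
  move=> a x y; rewrite /A scaler_sumr -big_split; apply: eq_bigr => i _ /=.
  by rewrite ricP scalerDl scalerA.
pose Al : {linear L -> L} := HB.pack A (GRing.isLinear.Build R L L *:%R A Alin).
have AE x : linfun Al x = A x by rewrite lfunE.
pose N : 'M[R]_4 := \matrix_(i, j) coord X j (linfun Al X`_i).
have NE : N = 4^-1 *: ricci4_mx c.
  apply/matrixP => i j; rewrite !mxE AE coord_sum_free ?(basis_free XB) //.
(* [ricci4_mx] is four times the Ricci matrix, so sample points are divided by 4. *)
have chiN a : (char_poly N).[4^-1 * a] = 4^-1 ^+ 4 * chi a.
  by rewrite horner_char_poly NE -scale_scalar_mx -scalerBr detZ.
have i4 : 0 < 4^-1 :> R by rewrite invr_gt0.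
have q0 : 0 < 4^-1 ^+ 4 :> R by rewrite exprn_gt0 // invr_gt0.
have [x0 [x1 [x2 [x3 [charN x0a x1a x2a x3a]]]]] :
    exists x0 x1 x2 x3,
      [/\ char_poly N = \prod_(x <- [:: x0; x1; x2; x3]) ('X - x%:P),
          x0 < 4^-1 * a1, x1 < 4^-1 * a2, x2 < 4^-1 * 0 & 4^-1 * 0 < x3].
  apply: (@four_roots _ (char_poly N) (4^-1 * a0) _ _ _ (4^-1 * a4));
    rewrite ?char_poly_monic ?size_char_poly // ?chiN ?ltr_pM2l ?invr_gt0 //;
    by rewrite ?pmulr_rlt0 ?pmulr_rgt0.
rewrite mulr0 in x2a x3a.
have x1n : x1 < 0 by rewrite (lt_trans x1a) // pmulr_rlt0 ?invr_gt0.
have x0n : x0 < 0.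
  by rewrite (lt_trans x0a) // pmulr_rlt0 ?invr_gt0 // (lt_trans a12).
exists (std_dot XB), (std_skew X), (linfun (std_rotation X)), nabla; split=> //.
- split=> [|x|x y]; last 2 first.
  + by rewrite !lfunE /= std_rotationK.
  + by rewrite lfunE /= std_form_rotation.
  by split=> //; exact: std_form_nondegenerate.
- move=> x ricx; have Nu : N \in unitmx.
    rewrite unitmxE unitfE; apply: contraTneq chi3 => detN.
    have /eqP := chiN 0; rewrite mulr0 horner_char_poly raddf0 sub0r -scaleN1r detZ.
    rewrite detN mulr0 eq_sym mulf_eq0 (gt_eqF q0) /= => /eqP ->.
    by rewrite ltxx.
  apply: (coord_inj XB) => i; rewrite linear0.
  suff /rowP/(_ i) : \row_i coord X i x = 0 by rewrite !mxE.
  rewrite -[LHS](mulmxK Nu) (_ : _ *m N = 0) ?mul0mx //.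
  apply/rowP => j; rewrite !mxE.
  transitivity (coord X j (A x)).
    rewrite -AE [in RHS](coord_basis XB (memvf x)) !linear_sum /=.
    by apply: eq_bigr => k _; rewrite !mxE !linearZ.
  by rewrite /A big1 ?linear0 // => k _; rewrite ricx scale0r.
- exists [:: x0; x1; x2; x3]; last first.
    by rewrite /= x0n x1n x2a x3a !ltNge !ltW.
  exists (linfun Al) => [x y|]; last by rewrite (char_poly_basis _ XB).
  rewrite AE.
  have ricsum : ricci nabla x y = \sum_(k < 4) coord X k y * ricci nabla x X`_k.
    have ric0 : ricci nabla x 0 = 0.
      have /(congr1 (fun t => t - ricci nabla x 0)) := ricPr x 1 0 0.
      by rewrite scale1r addr0 mul1r addrK subrr.
    rewrite {1}(coord_basis XB (memvf y)).
    apply: (big_ind2 (fun u r => ricci nabla x u = r)) => // [u r v s <- <-|k _].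
      by rewrite -[u in LHS]scale1r ricPr mul1r.
    by rewrite -[X in ricci nabla x X]addr0 ricPr ric0 addr0.
  rewrite ricsum /std_dot /= /std_metric; apply: eq_bigr => k _.
  by rewrite coord_sum_free ?(basis_free XB) // mulrC.
Qed.



End AlmostKahlerOfBasis.

(** * Explicit determinants, closedness on a basis, and algebras given by bracket tables *)

Section Det4.
Context {K : comNzRingType}.

(** Laplace expansion along the first two rows, by complementary 2 x 2 minors. *)
Lemma det4 (F : nat -> nat -> K) :
  \det (\matrix_(i < 4, j < 4) F i j)
  = (F 0%N 0%N * F 1%N 1%N - F 0%N 1%N * F 1%N 0%N) * (F 2%N 2%N * F 3%N 3%N - F 2%N 3%N * F 3%N 2%N)
  - (F 0%N 0%N * F 1%N 2%N - F 0%N 2%N * F 1%N 0%N) * (F 2%N 1%N * F 3%N 3%N - F 2%N 3%N * F 3%N 1%N)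
  + (F 0%N 0%N * F 1%N 3%N - F 0%N 3%N * F 1%N 0%N) * (F 2%N 1%N * F 3%N 2%N - F 2%N 2%N * F 3%N 1%N)
  + (F 0%N 1%N * F 1%N 2%N - F 0%N 2%N * F 1%N 1%N) * (F 2%N 0%N * F 3%N 3%N - F 2%N 3%N * F 3%N 0%N)
  - (F 0%N 1%N * F 1%N 3%N - F 0%N 3%N * F 1%N 1%N) * (F 2%N 0%N * F 3%N 2%N - F 2%N 2%N * F 3%N 0%N)
  + (F 0%N 2%N * F 1%N 3%N - F 0%N 3%N * F 1%N 2%N) * (F 2%N 0%N * F 3%N 1%N - F 2%N 1%N * F 3%N 0%N).
Proof.
rewrite (expand_det_row _ ord0) !big_ord_recl big_ord0 /cofactor.
do 2?rewrite !(expand_det_row _ ord0) !big_ord_recl !big_ord0 /cofactor.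
rewrite !det_mx11 !mxE /= /bump /=.
ring.
Qed.

(** Replacing the sums by a table of values before expanding the determinant keeps the final [ring]
    identities small. *)
Lemma char_ricci4E (c : nat -> nat -> nat -> K) (F : nat -> nat -> K) a :
  (forall i j, (i < 4)%N -> (j < 4)%N -> ricci4 c i j = F i j) ->
  \det (a%:M - ricci4_mx c)
    = \det (\matrix_(i < 4, j < 4) (a *+ (i == j :> nat) - F i j)).
Proof.
move=> cF; congr (\det _); apply/matrixP => i j; rewrite !mxE cF //.
Qed.

Definition bracket_table (t : nat -> nat -> seq K) (i j k : nat) : K :=
  (t i j)`_k - (t j i)`_k.

End Det4.

Section Closed.
Context {R : realType} {L : lieAlgType R}.
Variables (X : 4.-tuple L) (XB : basis_of fullv X).

Lemma form_coord (w : {skew_symmetric L}) x y :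
  w x y = \sum_i \sum_j coord X i x * coord X j y * w X`_i X`_j.
Proof.
rewrite [x in LHS](coord_basis XB (memvf x)) [y in LHS](coord_basis XB (memvf y)).
rewrite linear_sumlz /=; apply: eq_bigr => i _; rewrite linear_sumr /=.
by apply: eq_bigr => j _; rewrite linearZl_LR linearZr_LR /=; ring.
Qed.

Lemma closed_form_basis (w : {skew_symmetric L}) :
  (forall i j k : 'I_4, w (lie X`_i X`_j) X`_k + w (lie X`_j X`_k) X`_i
      + w (lie X`_k X`_i) X`_j = 0) -> closed_form w.
Proof.
pose P x y z := w (lie x y) z + w (lie y z) x + w (lie z x) y.
(* By cyclic symmetry only the first slot has to be expanded: rotating the arguments brings each
   slot there in turn. *)
have PC x y z : P x y z = P y z x by rewrite /P [RHS](ACl (3*1*2))%AC.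
have PS x y z : P x y z = \sum_i coord X i x * P X`_i y z.
  rewrite {1}(coord_basis XB (memvf x)) /P.
  rewrite !(linear_sumlz, linear_sumr) -!big_split /=; apply: eq_bigr => i _.
  by rewrite !(linearZl_LR, linearZr_LR) /= ?linearZl_LR /=; ring.
move=> cl x y z; rewrite -[LHS]/(P x y z) PS big1 // => i _.
rewrite PC PS big1 ?mulr0 // => j _; rewrite PC PS big1 ?mulr0 // => k _.
by rewrite PC [P _ _ _]cl mulr0.
Qed.

End Closed.

Section Tables.
Context {K : comNzRingType}.

(* [rij] lists the coordinates of the bracket [e_i, e_j] for i < j. *)
Definition table6 (r01 r02 r03 r12 r13 r23 : seq K) (i j : nat) : seq K :=
  match i, j with
  | 0, 1 => r01 | 0, 2 => r02 | 0, 3 => r03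
  | 1, 2 => r12 | 1, 3 => r13 | 2, 3 => r23
  | _, _ => [::]
  end%N.

End Tables.

Section TableAlgebra.
Context {R : realType} {L : lieAlgType R}.
Variables (X : 4.-tuple L) (XB : basis_of fullv X).

Definition vec4s (r : seq R) : L := vec4 X r`_0 r`_1 r`_2 r`_3.

Lemma structure_constants_table r01 r02 r03 r12 r13 r23 :
  lie X`_0 X`_1 = vec4s r01 -> lie X`_0 X`_2 = vec4s r02 ->
  lie X`_0 X`_3 = vec4s r03 -> lie X`_1 X`_2 = vec4s r12 ->
  lie X`_1 X`_3 = vec4s r13 -> lie X`_2 X`_3 = vec4s r23 ->
  structure_constants X (bracket_table (table6 r01 r02 r03 r12 r13 r23)).
Proof.
move=> h01 h02 h03 h12 h13 h23.
have pos (r : seq R) : vec4s r = \sum_(k < 4) (r`_k - 0) *: X`_k.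
  by rewrite (sum4 (fun k => (r`_k - 0) *: X`_k)) !subr0.
have neg (r : seq R) : - vec4s r = \sum_(k < 4) (0 - r`_k) *: X`_k.
  rewrite (sum4 (fun k => (0 - r`_k) *: X`_k)) /vec4s /vec4 !sub0r !scaleNr.
  by rewrite !opprD.
rewrite /bracket_table => -[[|[|[|[|]]]] // i4] -[[|[|[|[|]]]] // j4] /=;
  try (by rewrite liexx big1 // => k _; rewrite nth_nil subrr scale0r);
  try (rewrite ?(h01, h02, h03, h12, h13, h23) pos;
       by apply: eq_bigr => k _; rewrite nth_nil);
  by rewrite lieC ?(h01, h02, h03, h12, h13, h23) neg; apply: eq_bigr => k _; rewrite nth_nil.
Qed.

(** The tensor w([e_i, e_j], e_k) of the form w = e^01 + e^23. *)
Definition std_torsion (c : nat -> nat -> nat -> R) (i j k : nat) : R :=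
  c i j 0%N * (k == 1%N)%:R - c i j 1%N * (k == 0%N)%:R
  + c i j 2%N * (k == 3%N)%:R - c i j 3%N * (k == 2%N)%:R.

Lemma std_form_lie c (i j k : 'I_4) : structure_constants X c ->
  std_form X (lie X`_i X`_j) X`_k = std_torsion c i j k.
Proof.
move=> cX; rewrite /std_form !(coord_lie XB cX) !coord_nth // !inordK //.
by rewrite /std_torsion ![_ == nat_of_ord k]eq_sym.
Qed.

Lemma closed_std_form c : structure_constants X c ->
  (forall i j k, (i < 4)%N -> (j < 4)%N -> (k < 4)%N ->
     std_torsion c i j k + std_torsion c j k i + std_torsion c k i j = 0) ->
  closed_form (std_form X).
Proof.
move=> cX clT; apply: (@closed_form_basis _ _ X XB (std_skew X)) => i j k.
by rewrite /= -[RHS](clT i j k) // !(std_form_lie _ _ _ cX).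
Qed.
End TableAlgebra.

(** * Two algebras with an explicit solution *)

Section SpecialAlgebras.
Context {R : realType} {L : lieAlgType R}.
Variables (X : 4.-tuple L) (XB : basis_of fullv X).

(* r_{4,-1,-1} in Ovando's list of symplectic Lie algebras.  Here 4 Ric has the
   eigenvalues -20, -4 and the two square roots of 160. *)
Lemma ricci13_of_r4m1m1 :
  lie X`_0 X`_1 = 0 -> lie X`_0 X`_2 = X`_0 -> lie X`_0 X`_3 = 0 ->
  lie X`_1 X`_2 = 2 *: X`_0 - X`_1 -> lie X`_1 X`_3 = 0 -> lie X`_2 X`_3 = X`_3 ->
  admits_ricci13 L.
Proof.
move=> h01 h02 h03 h12 h13 h23.
pose t : nat -> nat -> seq R := table6 [::] [:: 1] [::] [:: 2; -1] [::] [:: 0; 0; 0; 1].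
pose F (i j : nat) : R := nth 0 (nth [::]
  [:: [:: 12; -4]; [:: -4; -12]; [:: 0; 0; -20]; [:: 0; 0; 0; -4]] i) j.
have cX : structure_constants X (bracket_table t).
  by apply: structure_constants_table;
    rewrite ?(h01, h02, h03, h12, h13, h23) /vec4s /vec4 /=
      ?(scale0r, addr0, add0r, scale1r, scaleN1r).
have cF i j : (i < 4)%N -> (j < 4)%N -> ricci4 (bracket_table t) i j = F i j.
  case: i => [|[|[|[|]]]] //; case: j => [|[|[|[|]]]] // _ _;
  by rewrite /ricci4 /christoffel2 !big_ord_recl !big_ord0 /bracket_table /t /F /bump /=; ring.
have chi a : \det (a%:M - ricci4_mx (bracket_table t)) = (a ^+ 2 - 160) * (a + 20) * (a + 4).
  by rewrite (char_ricci4E _ cF) (det4 (fun i j => a *+ (i == j) - F i j)) /F /=; ring.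
clear h01 h02 h03 h12 h13 h23.
(* The sample points separate the roots -20, -4 sqrt 10, -4 and 4 sqrt 10. *)
apply: (@ricci13_of_signs _ _ _ XB _ cX (-21) (-15) (-10) 20); rewrite ?chi; try lra.
apply: (closed_std_form XB cX) => i j k.
by case: i => [|[|[|[|]]]] //; case: j => [|[|[|[|]]]] //; case: k => [|[|[|[|]]]] // _ _ _;
  rewrite /std_torsion /bracket_table /t /=; ring.
Qed.

(* The [X`_2] component of [[X`_1, X`_3]] shears the frame away from the Kähler one,
   whose Ricci tensor is negative definite. *)
Lemma ricci13_of_complex_hyperbolic :
  lie X`_0 X`_1 = 2 *: X`_2 -> lie X`_0 X`_2 = 0 -> lie X`_0 X`_3 = X`_0 ->
  lie X`_1 X`_2 = 0 -> lie X`_1 X`_3 = X`_1 - 4 *: X`_2 -> lie X`_2 X`_3 = 2 *: X`_2 ->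
  admits_ricci13 L.
Proof.
move=> h01 h02 h03 h12 h13 h23.
pose t : nat -> nat -> seq R := table6 [:: 0; 0; 2] [::] [:: 1] [::] [:: 0; 1; -4] [:: 0; 0; 2].
pose F (i j : nat) : R := nth 0 (nth [::]
  [:: [:: -24; 0; 0; -16]; [:: 0; -56; 40]; [:: 0; 40; 8]; [:: -16; 0; 0; -56]] i) j.
have cX : structure_constants X (bracket_table t).
  by apply: structure_constants_table;
    rewrite ?(h01, h02, h03, h12, h13, h23) /vec4s /vec4 /=
      ?(scale0r, addr0, add0r, scale1r, scaleN1r, scaleNr).
have cF i j : (i < 4)%N -> (j < 4)%N -> ricci4 (bracket_table t) i j = F i j.
  case: i => [|[|[|[|]]]] //; case: j => [|[|[|[|]]]] // _ _;
  by rewrite /ricci4 /christoffel2 !big_ord_recl !big_ord0 /bracket_table /t /F /bump /=; ring.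
have chi a : \det (a%:M - ricci4_mx (bracket_table t))
    = (a ^+ 2 + 80 * a + 1088) * (a ^+ 2 + 48 * a - 2048).
  by rewrite (char_ricci4E _ cF) (det4 (fun i j => a *+ (i == j) - F i j)) /F /=; ring.
clear h01 h02 h03 h12 h13 h23.
(* The roots are, in increasing order, -24 - 8 sqrt 41, -40 - 16 sqrt 2, -40 + 16 sqrt 2 and -24 + 8
   sqrt 41. *)
apply: (@ricci13_of_signs _ _ _ XB _ cX (-80) (-70) (-40) 40); rewrite ?chi; try lra.
apply: (closed_std_form XB cX) => i j k.
by case: i => [|[|[|[|]]]] //; case: j => [|[|[|[|]]]] //; case: k => [|[|[|[|]]]] // _ _ _;
  rewrite /std_torsion /bracket_table /t /=; ring.
Qed.

End SpecialAlgebras.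

(** * The Ricci tensor as a polynomial in a parameter, and the filiform algebra *)

Lemma horner_gt0_near (R : rcfType) (p : {poly R}) :
  0 < p.[0] -> exists2 d, 0 < d & forall e, 0 < e < d -> 0 < p.[e].
Proof.
move=> p0; have [d d0 dP] := poly_cont 0 p p0; exists d => // e /andP[e0 ed].
have := dP e; rewrite subr0 gtr0_norm // => /(_ ed); rewrite ltr_norml.
by rewrite ltrBrDr addrC subrr => /andP[].
Qed.

(** Meant for evaluation: with polynomial structure constants the Ricci entries are polynomials,
    whose values are the Ricci entries of the evaluated constants. *)
Lemma ricci4_morph (K K' : comNzRingType) (f : {rmorphism K -> K'})
    (c : nat -> nat -> nat -> K) j k :
  f (ricci4 c j k) = ricci4 (fun x y z => f (c x y z)) j k.
Proof.
have fG x y z : f (christoffel2 c x y z) = christoffel2 (fun x y z => f (c x y z)) x y z.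
  by rewrite /christoffel2 rmorphD rmorphB.
rewrite /ricci4 rmorph_sum; apply: eq_bigr => i _.
rewrite rmorph_sum; apply: eq_bigr => m _.
by rewrite !rmorphB rmorphMn !rmorphM !fG.
Qed.

Lemma eq_ricci4 (K : comNzRingType) (c c' : nat -> nat -> nat -> K) j k :
  (j < 4)%N -> (k < 4)%N ->
  (forall x y z, (x < 4)%N -> (y < 4)%N -> (z < 4)%N -> c x y z = c' x y z) ->
  ricci4 c j k = ricci4 c' j k.
Proof.
move=> j4 k4 cc; apply: eq_bigr => i _; apply: eq_bigr => m _.
by rewrite /christoffel2 !cc.
Qed.

Section Filiform.
Context {R : realType}.
Variables A B : R.

Definition filiform_table : nat -> nat -> seq R :=
  table6 [::] [::] [:: 0; - A] [::] [:: 0; 0; - B] [::].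

Lemma filiform_char a :
  \det (a%:M - ricci4_mx (bracket_table filiform_table))
  = (a + 2 * A ^+ 2) * (a - 2 * (A ^+ 2 - B ^+ 2)) * (a - 2 * B ^+ 2)
    * (a + 2 * (A ^+ 2 + B ^+ 2)).
Proof.
pose d := [:: - (2 * A ^+ 2); 2 * (A ^+ 2 - B ^+ 2); 2 * B ^+ 2; - (2 * (A ^+ 2 + B ^+ 2))].
pose F (i j : nat) : R := d`_i *+ (i == j).
have cF i j : (i < 4)%N -> (j < 4)%N -> ricci4 (bracket_table filiform_table) i j = F i j.
  case: i => [|[|[|[|]]]] //; case: j => [|[|[|[|]]]] // _ _;
  by rewrite /ricci4 /christoffel2 !big_ord_recl !big_ord0 /bracket_table /F /d /bump /=; ring.
by rewrite (char_ricci4E _ cF) (det4 (fun i j => a *+ (i == j) - F i j)) /F /d /=; ring.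
Qed.

End Filiform.

(** * Bases of four vectors and Darboux frames *)

Section Basis4.
Context {R : fieldType} {L : lieAlgType R}.

Lemma basis4 (X : 4.-tuple L) : \dim {:L} = 4%N ->
  (forall a b c d, vec4 X a b c d = 0 -> [/\ a = 0, b = 0, c = 0 & d = 0]) ->
  basis_of fullv X.
Proof.
move=> dimL X0; rewrite basisEfree subvf size_tuple dimL !andbT.
apply/freeP => k k0 i; have := k0.
rewrite sum_ord4 !inordK // => /X0[k0' k1 k2 k3].
by rewrite -[i]inord_val; case: i => -[|[|[|[|]]]].
Qed.

Lemma vec4_eq0 (X : 4.-tuple L) a b c d : basis_of fullv X ->
  vec4 X a b c d = 0 -> [/\ a = 0, b = 0, c = 0 & d = 0].
Proof.
by move=> XB e; case: (coord_vec4 a b c d XB); rewrite e !linear0 => -> -> -> ->.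
Qed.

End Basis4.

Section Darboux.
Context {R : realType} {L : lieAlgType R}.

Definition darboux (w : L -> L -> R) (X : 4.-tuple L) : Prop :=
  [/\ w X`_0 X`_1 = 1, w X`_2 X`_3 = 1, w X`_0 X`_2 = 0 & w X`_0 X`_3 = 0] /\
  w X`_1 X`_2 = 0 /\ w X`_1 X`_3 = 0.

Lemma skewC (w : {skew_symmetric L}) x y : w x y = - w y x.
Proof. by rewrite (hermitian_subproof x y) expr1 mulN1r. Qed.

Lemma skewxx (w : {skew_symmetric L}) x : w x x = 0.
Proof. by have := skewC w x x; lra. Qed.

(** The factor [l] allows for rescaled Darboux frames, for which [w] is only a multiple of the
    standard form. *)
Lemma std_form_scaled (w : {skew_symmetric L}) (X : 4.-tuple L) l :
  basis_of fullv X -> w X`_0 X`_1 = l -> w X`_2 X`_3 = l ->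
  w X`_0 X`_2 = 0 -> w X`_0 X`_3 = 0 -> w X`_1 X`_2 = 0 -> w X`_1 X`_3 = 0 ->
  forall x y, w x y = l * std_form X x y.
Proof.
move=> XB w01 w23 w02 w03 w12 w13 x y.
rewrite (form_coord XB) sum_ord4 !sum_ord4 !inordK // !skewxx.
rewrite (skewC w X`_1 X`_0) (skewC w X`_2 X`_0) (skewC w X`_3 X`_0) (skewC w X`_2 X`_1)
  (skewC w X`_3 X`_1).
rewrite (skewC w X`_3 X`_2) w01 w02 w03 w12 w13 w23 /std_form.
by ring.
Qed.

End Darboux.

(** * Degeneration of a Darboux frame to the filiform algebra *)

Section FiliformLimit.
Context {R : realType} {L : lieAlgType R}.
Hypothesis dimL : \dim {:L} = 4%N.
Variables (X : 4.-tuple L) (XB : basis_of fullv X).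
Variables (c : nat -> nat -> nat -> R) (cX : structure_constants X c).

(* With the weights [n] all structure constants of the rescaled frame tend to 0
   with [e], except those of [[e_3, e_0]] on [e_1] and of [[e_3, e_1]] on [e_2];
   the weight of the component of [[e_3, e_0]] on [e_2] would be negative. *)
Let m (u : R) (i : nat) : R := [:: 1; 1; u^-1; u]`_i.
Let n (i : nat) : nat := nth 0%N [:: 4; 6; 8; 2]%N i.
Let s u e i := m u i * e ^+ n i.
Let Y (u e : R) : 4.-tuple L :=
  [tuple s u e 0 *: X`_0; s u e 1 *: X`_1; s u e 2 *: X`_2; s u e 3 *: X`_3].

(** The structure constants of the frame [Y u e] as polynomials in [e]. Where the subtraction in the
    exponent truncates, [c i j k] will be zero. *)
Let cp u i j k : {poly R} := (c i j k * m u i * m u j / m u k)%:P * 'X^(n i + n j - n k).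

Let s_neq0 u e i : u != 0 -> e != 0 -> (i < 4)%N -> s u e i != 0.
Proof.
move=> u0 e0; case: i => [|[|[|[|]]]] // _;
by rewrite /s /m /= mulf_neq0 ?expf_neq0 ?invr_eq0 ?oner_eq0.
Qed.

Let YE u e i : (i < 4)%N -> (Y u e)`_i = s u e i *: X`_i.
Proof. by case: i => [|[|[|[|]]]]. Qed.

Let scaled_basis u e : u != 0 -> e != 0 -> basis_of fullv (Y u e).
Proof.
move=> u0 e0; have Z i x : (i < 4)%N -> x * s u e i = 0 -> x = 0.
  by move=> i4 /eqP; rewrite mulf_eq0 (negPf (s_neq0 u0 e0 i4)) orbF => /eqP.
apply: basis4 => // a b c' d; rewrite /vec4 !YE // !scalerA.
by case/(vec4_eq0 XB) => /Z-> // /Z-> // /Z-> // /Z->.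
Qed.

Let scaled_constants u e : u != 0 -> e != 0 ->
  (forall i j k, (n i + n j < n k)%N -> (i < 4)%N -> (j < 4)%N -> (k < 4)%N -> c i j k = 0) ->
  structure_constants (Y u e) (fun i j k => (cp u i j k).[e]).
Proof.
move=> u0 e0 c0.
move=> i j; rewrite !YE // linearZl_LR linearZr_LR /= cX !scaler_sumr.
apply: eq_bigr => k _; rewrite YE // !scalerA; congr (_ *: _).
rewrite /cp hornerCM hornerXn /s.
have m0 : m u k != 0 by case: (k) => -[|[|[|[|]]]] //= _; rewrite ?oner_eq0 ?invr_eq0.
have [nk|nk] := leqP (n k) (n i + n j); last by rewrite c0 // !mul0r !mulr0.
transitivity (c i j k * m u i * m u j * e ^+ (n i + n j)); first by rewrite exprD; ring.
by rewrite -[in LHS](subnK nk) exprD; field.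
Qed.

(** At [e = 0] the rescaled constants are filiform, and the signs of the characteristic polynomial
    at five points between its roots persist for small positive [e]. *)
Lemma ricci13_of_filiform_limit (w : {skew_symmetric L}) :
  closed_form w -> darboux w X ->
  coord X (inord 2) (lie X`_3 X`_0) = 0 ->
  coord X (inord 1) (lie X`_3 X`_0) != 0 ->
  coord X (inord 2) (lie X`_3 X`_1) != 0 -> admits_ricci13 L.
Proof.
move=> wcl wX c302 a0 b0.
have cE i j k : (i < 4)%N -> (j < 4)%N -> (k < 4)%N ->
    c i j k = coord X (inord k) (lie X`_i X`_j).
  move=> i4 j4 k4; rewrite -(inordK i4) -(inordK j4) (coord_lie XB cX).
  by rewrite !inordK.
have cC i j k : (i < 4)%N -> (j < 4)%N -> (k < 4)%N -> c i j k = - c j i k.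
  by move=> i4 j4 k4; rewrite !cE // [in LHS]lieC linearN.
have cxx i k : (i < 4)%N -> (k < 4)%N -> c i i k = 0.
  by move=> i4 k4; rewrite cE // liexx linear0.
have z302 : c 3 0 2 = 0 by rewrite cE.
have z032 : c 0 3 2 = 0 by rewrite cC // z302 oppr0.
have c0 i j k : (n i + n j < n k)%N -> (i < 4)%N -> (j < 4)%N -> (k < 4)%N -> c i j k = 0.
  case: i => [|[|[|[|]]]] //; case: j => [|[|[|[|]]]] //; case: k => [|[|[|[|]]]] // _ _ _ _;
  by rewrite ?cxx ?z302 ?z032.
rewrite -cE // in a0; rewrite -cE // in b0.
set a := c _ _ _ in a0; set b := c _ _ _ in b0.
(* The scaling by [m u] multiplies [a] by [u] and [b] by [u ^+ 2]; this [u] is large enough to force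
   [2 * A ^+ 2 < B ^+ 2]. *)
pose u := 1 + 2 * a ^+ 2 / b ^+ 2.
have b2 : 0 < b ^+ 2 by rewrite exprn_even_gt0.
have a2 : 0 < a ^+ 2 by rewrite exprn_even_gt0.
have u1 : 1 < u by rewrite ltrDl divr_gt0 // mulr_gt0.
have u0 : u != 0 by rewrite gt_eqF // (lt_trans _ u1).
have ub : u * b ^+ 2 = b ^+ 2 + 2 * a ^+ 2 by rewrite /u; field.
pose A := u * a; pose B := u ^+ 2 * b.
have AB : 2 * A ^+ 2 < B ^+ 2.
  have -> : B ^+ 2 = u ^+ 2 * (u * (u * b ^+ 2)) by rewrite /B; ring.
  have -> : 2 * A ^+ 2 = u ^+ 2 * (2 * a ^+ 2) by rewrite /A; ring.
  rewrite ub ltr_pM2l ?exprn_even_gt0 //.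
  have : 0 < (u - 1) * (b ^+ 2 + 2 * a ^+ 2) by rewrite mulr_gt0 //; lra.
  by lra.
have A2 : 0 < A ^+ 2 by rewrite exprn_even_gt0 // mulf_neq0.
(* In the limit 4 Ric has the eigenvalues -2(A^2 + B^2) < 2(A^2 - B^2) < -2A^2 < 2B^2; by [AB] the
   value -B^2 lies between the second and the third. *)
have [o01 o12 o20 o04] : [/\ - (4 * (A ^+ 2 + B ^+ 2)) < - (2 * B ^+ 2),
    - (2 * B ^+ 2) < - B ^+ 2, - B ^+ 2 < 0 & 0 < 4 * B ^+ 2] by split; lra.
(* The polynomial variable is the scaling parameter. The value at 0 makes sense although the
   rescaled vectors form no frame there. *)
pose P x : {poly R} := \det (x%:P%:M - ricci4_mx (cp u)).
have PE x e : (P x).[e] = \det (x%:M - ricci4_mx (fun i j k => (cp u i j k).[e])).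
  rewrite /P -horner_evalE -det_map_mx; congr (\det _); apply/matrixP => i j.
  rewrite !mxE rmorphB rmorphMn /= ricci4_morph /=.
  by rewrite /horner_eval hornerC.
have P0 x : (P x).[0] = (x + 2 * A ^+ 2) * (x - 2 * (A ^+ 2 - B ^+ 2)) * (x - 2 * B ^+ 2)
    * (x + 2 * (A ^+ 2 + B ^+ 2)).
  rewrite PE -filiform_char; congr (\det (_ - _)); apply/matrixP => j k; rewrite !mxE.
  apply: eq_ricci4 => // {j k} i j k; rewrite /cp hornerCM hornerXn expr0n.
  case: i => [|[|[|[|]]]] //; case: j => [|[|[|[|]]]] //; case: k => [|[|[|[|]]]] // _ _ _;
  rewrite /m /bracket_table /= ?cxx // ?mulr0 ?mulr1 ?subr0 ?invr1 ?mul0r ?mulr1 ?divr1 ?z302 ?z032 //;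
  rewrite ?mul0r ?invrK // /A /B -?[c 3 0 1]/a -?[c 3 1 2]/b;
  try (by ring); by rewrite cC // -?[c 3 0 1]/a -?[c 3 1 2]/b; ring.
have neg (p : {poly R}) : p.[0] < 0 -> exists2 d, 0 < d & forall e, 0 < e < d -> p.[e] < 0.
  rewrite -oppr_gt0 -hornerN => /horner_gt0_near[d d0 dP]; exists d => // e /dP.
  by rewrite hornerN oppr_gt0.
have p0 : 0 < (P (- (4 * (A ^+ 2 + B ^+ 2)))).[0].
  rewrite P0.
  have -> : forall p q r s : R, p * q * r * s = (- p) * (- q) * ((- r) * (- s)) by move=> *; ring.
  by do 2?apply: mulr_gt0; lra.
have p1 : (P (- (2 * B ^+ 2))).[0] < 0.
  rewrite P0 -oppr_gt0.
  have -> : forall p q r s : R, - (p * q * r * s) = (- p) * (- q) * ((- r) * s) by move=> *; ring.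
  by do 2?apply: mulr_gt0; lra.
have p2 : 0 < (P (- B ^+ 2)).[0].
  rewrite P0.
  have -> : forall p q r s : R, p * q * r * s = (- p) * q * ((- r) * s) by move=> *; ring.
  by do 2?apply: mulr_gt0; lra.
have p3 : (P 0).[0] < 0.
  rewrite P0 -oppr_gt0.
  have -> : forall p q r s : R, - (p * q * r * s) = p * q * ((- r) * s) by move=> *; ring.
  by do 2?apply: mulr_gt0; lra.
have p4 : 0 < (P (4 * B ^+ 2)).[0].
  rewrite P0; do 3?apply: mulr_gt0; lra.
have [d0 d00 e0P] := horner_gt0_near p0.
have [d1 d10 e1P] := neg _ p1.
have [d2 d20 e2P] := horner_gt0_near p2.
have [d3 d30 e3P] := neg _ p3.
have [d4 d40 e4P] := horner_gt0_near p4.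
pose d := Num.min d0 (Num.min d1 (Num.min d2 (Num.min d3 d4))).
have dd : 0 < d by rewrite !lt_min d00 d10 d20 d30.
pose e := d / 2.
have e0 : 0 < e by rewrite divr_gt0.
have ed : e < d by rewrite /e ltr_pdivrMr // ltr_pMr // ltr1n.
have /and5P[h0 h1 h2 h3 h4] : [&& e < d0, e < d1, e < d2, e < d3 & e < d4].
  by move: ed; rewrite /d !lt_min.
have YB := scaled_basis u0 (lt0r_neq0 e0).
have cY := scaled_constants u0 (lt0r_neq0 e0) c0.
apply: (@ricci13_of_signs _ _ _ YB _ cY _ _ _ _ _ o01 o12 o20 o04); rewrite -?PE;
  rewrite ?e0P ?e1P ?e2P ?e3P ?e4P ?e0 //.
(* The weights satisfy n_0 + n_1 = n_2 + n_3 = 10 and m_0 m_1 = m_2 m_3 = 1, so [Y] is Darboux up to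
   the factor [e ^+ 10], and closedness carries over. *)
have wY x y : w x y = e ^+ 10 * std_form (Y u e) x y.
  case: wX => -[w01 w23 w02 w03] [w12 w13].
  by apply: std_form_scaled => //; rewrite !YE // linearZl_LR linearZr_LR /=
    ?w01 ?w23 ?w02 ?w03 ?w12 ?w13 ?mulr0 // /s /m /=; field.
move=> x y z; have := wcl x y z; rewrite !wY -!mulrDr => /eqP.
by rewrite mulf_eq0 expf_eq0 /= (gt_eqF e0) => /eqP.
Qed.
End FiliformLimit.

(** * Symplectic linear algebra *)

Section SymplecticLinearAlgebra.
Context {R : realType} {L : lieAlgType R}.
Variable w : {skew_symmetric L}.
Hypothesis wnd : nondegenerate_form w.

Lemma nondegenerate_witness v : v != 0 -> exists y, w v y != 0.
Proof.
move=> v0; have [/existsP[i wi]|] := boolP [exists i : 'I_(\dim {:L}), w v (vbasis {:L})`_i != 0].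
  by exists (vbasis {:L})`_i.
rewrite negb_exists => /forallP wv0; case/eqP: v0; apply: wnd => y.
rewrite (coord_vbasis (memvf y)) linear_sumr big1 // => i _.
by rewrite linearZr_LR /=; have := wv0 i; rewrite negbK => /eqP ->; rewrite mulr0.
Qed.

(** Nondegeneracy makes the map from vectors to their pairings with a basis injective, hence
    surjective by dimension. *)
Lemma riesz (f : L -> R) : (forall a x y, f (a *: x + y) = a * f x + f y) ->
  exists v, forall y, w v y = f y.
Proof.
move=> flin; move: (vbasis {:L}) (vbasisP {:L}); move: (\dim {:L}) => n e eB.
pose p v : 'rV[R]_n := \row_i w v e`_i.
have plin : linear p by move=> a x y; apply/rowP => i; rewrite !mxE linearPl.
pose pl : {linear L -> 'rV[R]_n} :=
  HB.pack p (GRing.isLinear.Build R L _ *:%R p plin).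
have wE x y : w x y = \sum_i coord e i y * w x e`_i.
  rewrite {1}(coord_basis eB (memvf y)) linear_sumr; apply: eq_bigr => i _.
  by rewrite linearZr_LR.
have ker0 : lker (linfun pl) == 0%VS.
  apply/lker0P => x y; rewrite !lfunE /= => /rowP pxy.
  apply/eqP; rewrite -subr_eq0; apply/eqP/wnd => z.
  rewrite linearBl /= !wE -sumrB big1 // => i _.
  by have := pxy i; rewrite !mxE => ->; rewrite subrr.
have imT : limg (linfun pl) = fullv.
  apply/eqP; rewrite eqEdim subvf /= dimvf /dim /= mul1n -[leqLHS](size_basis eB).
  by rewrite -(limg_ker_dim (linfun pl) fullv) (eqP ker0) capv0 dimv0.
have /memv_imgP[v _ pv] : \row_i f e`_i \in limg (linfun pl) by rewrite imT memvf.
exists v => y; rewrite wE [in RHS](coord_basis eB (memvf y)).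
have f0 : f 0 = 0.
  have /(congr1 (fun t => t - f 0)) := flin 1 0 0.
  by rewrite scale1r addr0 mul1r addrK subrr.
symmetry; apply: (big_ind2 (fun u r => f u = r)) => // [u r u' r' <- <-|k _].
  by rewrite -[u in LHS]scale1r flin mul1r.
rewrite -[X in f X]addr0 flin f0 addr0; congr (_ * _).
by have /rowP/(_ k) := pv; rewrite lfunE /= !mxE.
Qed.

Hypothesis dimL : \dim {:L} = 4%N.

(** Pairing a linear relation with each vector of the frame isolates its coefficients. *)
Lemma darboux_basis (X : 4.-tuple L) : darboux w X -> basis_of fullv X.
Proof.
case=> -[w01 w23 w02 w03] [w12 w13]; apply: basis4 => // a b c d v0.
have E y : a * w X`_0 y + b * w X`_1 y + c * w X`_2 y + d * w X`_3 y = 0.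
  by have := congr1 (w^~ y) v0; rewrite /vec4 !linearDl /= !linearZl_LR linear0l.
have := E X`_0; have := E X`_1; have := E X`_2; have := E X`_3.
rewrite !skewxx (skewC w X`_1 X`_0) (skewC w X`_2 X`_0) (skewC w X`_3 X`_0).
rewrite (skewC w X`_2 X`_1) (skewC w X`_3 X`_1) (skewC w X`_3 X`_2).
rewrite w01 w02 w03 w12 w13 w23 => *; split; lra.
Qed.

(** Symplectic Gram-Schmidt starting from an isotropic plane: [v] and [x] become the first and last
    vectors of the frame, and their partners are constructed. *)
Lemma darboux_extension v x : w v x = 0 ->
  (forall a b, a *: v + b *: x = 0 -> a = 0 /\ b = 0) ->
  exists X : 4.-tuple L, [/\ darboux w X, X`_0 = v & X`_3 = x].
Proof.
move=> wvx indep.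
have v0 : v != 0.
  apply/eqP => v0; have [] := indep 1 0; last by move/eqP; rewrite oner_eq0.
  by rewrite v0 scaler0 scale0r addr0.
have [y' wvy'] := nondegenerate_witness v0.
have [y wvy] : exists y, w v y = 1.
  by exists ((w v y')^-1 *: y'); rewrite linearZr_LR /= mulVf.
(* Since [x'] is orthogonal to [y], a vector pairing nontrivially with [x'] can be corrected by a
   multiple of [y] to be orthogonal to [v], and it then still pairs nontrivially with [x]. *)
pose x' := x - w x y *: v.
have x'0 : x' != 0.
  apply/eqP; rewrite /x' addrC -scaleNr -[X in _ + X]scale1r => /indep[_ /eqP].
  by rewrite oner_eq0.
have [z0 wx'z0] := nondegenerate_witness x'0.
pose z1 := z0 - w v z0 *: y.
have wvz1 : w v z1 = 0 by rewrite linearBr linearZr_LR /= wvy mulr1 subrr.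
have wx'y : w x' y = 0 by rewrite linearBl linearZl_LR /= wvy mulr1 subrr.
have wxz1 : w x z1 != 0.
  suff -> : w x z1 = w x' z0 by [].
  transitivity (w x' z1); last by rewrite linearBr linearZr_LR /= wx'y mulr0 subr0.
  by rewrite linearBl linearZl_LR /= wvz1 mulr0 subr0.
have [z wxz wvz] : exists2 z, w x z = 1 & w v z = 0.
  by exists ((w x z1)^-1 *: z1); rewrite linearZr_LR /= ?mulVf // wvz1 mulr0.
pose e1 := y - w x y *: z.
have wve1 : w v e1 = 1 by rewrite linearBr linearZr_LR /= wvz mulr0 subr0.
have wxe1 : w x e1 = 0 by rewrite linearBr linearZr_LR /= wxz mulr1 subrr.
pose e2 := w z e1 *: v - z.
exists [tuple v; e1; e2; x]; split=> //; split; first split=> //=.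
- by rewrite linearBl linearZl_LR /= wvx mulr0 sub0r -skewC.
- by rewrite linearBr linearZr_LR /= skewxx mulr0 wvz subrr.
split=> /=; last by rewrite skewC wxe1 oppr0.
by rewrite skewC linearBl linearZl_LR /= wve1 mulr1 subrr oppr0.
Qed.

End SymplecticLinearAlgebra.

(** * Nonvanishing of the quintic N gives a solution *)

Section Quintic.
Context {R : realType} {L : lieAlgType R}.
Hypothesis dimL : \dim {:L} = 4%N.

(** Here [v] is v_x, quadratic in [x], so that N(x) = w([x, v], v) has degree five. If [v] and [x]
    were dependent, their bracket and hence N(x) would vanish. *)
Lemma ricci13_of_quintic (w : {skew_symmetric L}) x v : is_symplectic_form w ->
  (forall y, w v y = w (lie x y) x) -> w (lie x v) v != 0 -> admits_ricci13 L.
Proof.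
move=> [wnd wcl] vP Nx.
have wvx : w v x = 0 by rewrite vP liexx linear0l.
have indep a b : a *: v + b *: x = 0 -> a = 0 /\ b = 0.
  move=> ab; have [a0|a0] := eqVneq a 0.
    split=> //; move: ab; rewrite a0 scale0r add0r => /eqP; rewrite scaler_eq0.
    by case/orP => /eqP // x0; case/eqP: Nx; rewrite x0 linear0l linear0l.
  have vx : v = (- a^-1 * b) *: x.
    by rewrite mulNr scaleNr -scalerA; apply/eqP; rewrite -addr_eq0 -[v in X in X == 0]scale1r
      -(mulVf a0) -scalerA -scalerDr ab scaler0.
  have lxv : lie x v = 0 by rewrite vx linearZr_LR /= liexx scaler0.
  by case/eqP: Nx; rewrite lxv linear0l.
have [X [wX X0 X3]] := darboux_extension wnd wvx indep.
have XB := darboux_basis dimL wX.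
have wstd y z : w y z = std_form X y z.
  by case: wX => -[w01 w23 w02 w03] [w12 w13]; rewrite (std_form_scaled (l := 1) XB) ?mul1r.
pose c i j k := coord X (inord k) (lie X`_i X`_j).
have cX : structure_constants X c.
  move=> i j; rewrite [LHS](coord_basis XB (memvf _)); apply: eq_bigr => k _.
  by rewrite /c inord_val.
have cd y : coord X (inord 1) y = w v y /\ coord X (inord 2) y = w y x.
  rewrite -X0 -X3 !wstd /std_form !coord_nth // !inordK //=.
  by split; ring.
have cd1 y := (cd y).1; have cd2 y := (cd y).2.
(* The three coordinates are w(v, v) = 0, w(v, [x, v]) = - N(x) and w(v, e_1) = 1. *)
apply: (ricci13_of_filiform_limit dimL XB cX wcl wX); rewrite ?cd1 ?cd2 X3 ?X0.
- by rewrite -vP skewxx.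
- by rewrite skewC oppr_eq0.
by rewrite -vP -X0; case: wX => -[-> _ _ _] _; rewrite oner_eq0.
Qed.

End Quintic.

(** * The obstruction for the excluded algebras *)

Section LargeCenter.
Context {R : realType}.

(** An isomorphism-invariant property shared by the three excluded algebras that forces degenerate
    Ricci curvature for every metric. *)
Definition large_center (L : lieAlgType R) : Prop :=
  exists z1 z2 u : L, [/\ forall x, lie z1 x = 0, forall x, lie z2 x = 0,
    forall a b, a *: z1 + b *: z2 = 0 -> a = 0 /\ b = 0
    & forall x y, exists k, lie x y = k *: u].

Lemma large_center_iso (L M : lieAlgType R) :
  lie_isomorphic L M -> large_center M -> large_center L.
Proof.
move=> [f [f' fK f'K] flie] [z1 [z2 [u [z1c z2c z12 uP]]]].
have finj := can_inj fK.
exists (f' z1), (f' z2), (f' u); split.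
- by move=> x; apply: finj; rewrite flie f'K z1c linear0.
- by move=> x; apply: finj; rewrite flie f'K z2c linear0.
- by move=> a b /(congr1 f); rewrite linear0 linearD !linearZ /= !f'K; exact: z12.
move=> x y; have [k fk] := uP (f x) (f y); exists k.
by apply: finj; rewrite flie fk linearZ /= f'K.
Qed.

(** The Koszul formula makes [z] parallel; as [z] is central, torsion-freeness then gives nabla_z =
    0, so every term of R(x, z) vanishes. *)
Lemma ricci_central (L : lieAlgType R) (g : {dot L for idfun})
    (nabla : {bilinear L -> L -> L}) z : is_levi_civita g nabla ->
  (forall x, lie z x = 0) -> (forall x y, g (lie x y) z = 0) ->
  forall y, ricci nabla z y = 0.
Proof.
move=> lc zc zo y.
have zc' x : lie x z = 0 by apply/eqP; rewrite lieC oppr_eq0 zc.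
have nz x : nabla x z = 0.
  apply: (@metric_inj _ _ g) => t; rewrite (koszul_formula _ _ _ lc).
  by rewrite zc zc' zo !linear0l subr0 addr0 mulr0.
have zn x : nabla z x = 0 by rewrite -[LHS](subrK (nabla x z)) lc.1 zc nz addr0.
rewrite /ricci /lin_trace big1 // => i _.
by rewrite /curvature zc' linear0l !zn linear0r !subr0 linear0.
Qed.

Lemma large_center_degenerate (L : lieAlgType R) (g : {dot L for idfun})
    (nabla : {bilinear L -> L -> L}) :
  large_center L -> is_levi_civita g nabla -> ~ nondegenerate_form (ricci nabla).
Proof.
move=> [z1 [z2 [u [z1c z2c z12 uP]]]] lc nd.
have main z : z <> 0 -> (forall x, lie z x = 0) -> g u z = 0 -> False.
  move=> z0 zc uz; apply/z0/nd/(ricci_central lc zc) => x y.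
  by have [k ->] := uP x y; rewrite linearZl_LR /= uz mulr0.
have [g1|g1] := eqVneq (g u z1) 0.
  apply: main g1 => // z10; have [] := z12 1 0; last by move/eqP; rewrite oner_eq0.
  by rewrite z10 scaler0 scale0r addr0.
(* The combination of [z1] and [z2] that is orthogonal to [u]. *)
apply: (main (g u z2 *: z1 + (- g u z1) *: z2)) => [/z12[_ /eqP]|x|].
- by rewrite oppr_eq0 (negPf g1).
- by rewrite linearDl !linearZl_LR /= z1c z2c !scaler0 addr0.
by rewrite linearDr !linearZr_LR /=; ring.
Qed.

Lemma abelian_large_center : large_center (abelian_lie R 4).
Proof.
exists (delta_mx 0 0), (delta_mx 0 1), 0; split=> //.
  move=> a b /rowP e; have := e 0; have := e 1.
  by rewrite !mxE /= !mulr0 !mulr1 addr0 add0r.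
by move=> x y; exists 0; rewrite scaler0.
Qed.

Lemma heis3_large_center : large_center (heis3 R * abelian_lie R 1)%type.
Proof.
exists (delta_mx 0 2, 0), (0, delta_mx 0 0), (delta_mx 0 2, 0); split.
- by move=> x; congr pair; rewrite /lie /= /heis3_lie !mxE /= !mul0r subrr scale0r.
- by move=> x; congr pair; rewrite /lie /= /heis3_lie !mxE /= !mul0r subrr scale0r.
- move=> a b [/rowP/(_ 2) + /rowP/(_ 0)]; rewrite !mxE /= !mulr0 !mulr1 addr0 add0r.
  by [].
by move=> x y; eexists; congr pair; rewrite ?scaler0.
Qed.

Lemma aff1_large_center : large_center (aff1 R * abelian_lie R 2)%type.
Proof.
exists (0, delta_mx 0 0), (0, delta_mx 0 1), (delta_mx 0 1, 0); split.
- by move=> x; congr pair; rewrite /lie /= /aff1_lie !mxE /= !mul0r subrr scale0r.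
- by move=> x; congr pair; rewrite /lie /= /aff1_lie !mxE /= !mul0r subrr scale0r.
- move=> a b [_ /rowP e]; have := e 0; have := e 1; rewrite !mxE /= !mulr0 !mulr1 addr0 add0r.
  by [].
by move=> x y; eexists; congr pair; rewrite ?scaler0.
Qed.

End LargeCenter.

(** * Recognising the excluded algebras *)

Section IsoOfConstants.
Context {R : fieldType} {L M : lieAlgType R}.

Lemma iso_of_constants (X : 4.-tuple L) (Y : 4.-tuple M) c :
  basis_of fullv X -> basis_of fullv Y ->
  structure_constants X c -> structure_constants Y c -> lie_isomorphic L M.
Proof.
move=> XB YB cX cY.
have lin (V W : vectType R) (A : 4.-tuple V) (B : 4.-tuple W) :
    linear (fun x => \sum_i coord A i x *: B`_i).
  move=> k x y; rewrite scaler_sumr -big_split; apply: eq_bigr => i _ /=.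
  by rewrite linearP scalerDl scalerA.
pose F (V W : vectType R) (A : 4.-tuple V) (B : 4.-tuple W) : 'Hom(V, W) :=
  linfun (HB.pack (fun x => \sum_i coord A i x *: B`_i)
    (GRing.isLinear.Build R V W *:%R _ (lin V W A B)) : {linear V -> W}).
have FE (V W : vectType R) (A : 4.-tuple V) (B : 4.-tuple W) x :
    F V W A B x = \sum_i coord A i x *: B`_i by rewrite lfunE.
have FK (V W : vectType R) (A : 4.-tuple V) (B : 4.-tuple W) :
    basis_of fullv A -> basis_of fullv B -> cancel (F V W A B) (F W V B A).
  move=> AB BB x; rewrite FE [RHS](coord_basis AB (memvf x)); apply: eq_bigr => i _.
  by rewrite FE coord_sum_free // (basis_free BB).
exists (F _ _ X Y); first by exists (F _ _ Y X); exact: FK.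
have FX (i : 'I_4) : F _ _ X Y X`_i = Y`_i.
  rewrite FE (bigD1 i) //= coord_free ?(basis_free XB) // eqxx scale1r big1 ?addr0 //.
  by move=> j ji; rewrite coord_free ?(basis_free XB) // eq_sym (negPf ji) scale0r.
move=> x y; rewrite {1}(coord_basis XB (memvf x)) {1}(coord_basis XB (memvf y)).
rewrite (FE _ _ _ _ x) (FE _ _ _ _ y) !linear_sumlz linear_sum; apply: eq_bigr => i _.
rewrite !linear_sumr linear_sum; apply: eq_bigr => j _ /=.
rewrite !linearZl_LR !linearZr_LR !linearZ /= cX cY linear_sum; congr (_ *: (_ *: _)).
by apply: eq_bigr => k _; rewrite linearZ /= FX.
Qed.

End IsoOfConstants.

Section Excluded.
Context {R : realType}.

Definition excluded (L : lieAlgType R) : Prop :=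
  lie_isomorphic L (heis3 R * abelian_lie R 1)%type \/
  lie_isomorphic L (aff1 R * abelian_lie R 2)%type \/
  lie_isomorphic L (abelian_lie R 4).

Let Yh : 4.-tuple (heis3 R * abelian_lie R 1)%type :=
  [tuple (delta_mx 0 0, 0); (delta_mx 0 1, 0); (delta_mx 0 2, 0); (0, delta_mx 0 0)].

Let Ya : 4.-tuple (aff1 R * abelian_lie R 2)%type :=
  [tuple (delta_mx 0 0, 0); (delta_mx 0 1, 0); (0, delta_mx 0 0); (0, delta_mx 0 1)].

Let Yo : 4.-tuple (abelian_lie R 4) :=
  [tuple delta_mx 0 0; delta_mx 0 1; delta_mx 0 2; delta_mx 0 3].

Let YhB : basis_of fullv Yh.
Proof.
apply: basis4; first by rewrite dimvf.
move=> a b c d; rewrite /vec4 /= => -[/rowP e /rowP/(_ 0)].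
have := e 0; have := e 1; have := e 2.
by rewrite !mxE /= !mulr0 !mulr1 ?addr0 ?add0r.
Qed.

Let YaB : basis_of fullv Ya.
Proof.
apply: basis4; first by rewrite dimvf.
move=> a b c d; rewrite /vec4 /= => -[/rowP e /rowP e'].
have := e 0; have := e 1; have := e' 0; have := e' 1.
by rewrite !mxE /= !mulr0 !mulr1 ?addr0 ?add0r.
Qed.

Let YoB : basis_of fullv Yo.
Proof.
apply: basis4; first by rewrite dimvf.
move=> a b c d; rewrite /vec4 /= => /rowP e.
have := e 0; have := e 1; have := e 2; have := e 3.
by rewrite !mxE /= !mulr0 !mulr1 ?addr0 ?add0r.
Qed.

Let YhC : structure_constants Yh
  (bracket_table (table6 [:: 0; 0; 1] [::] [::] [::] [::] [::])).
Proof.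
by apply: structure_constants_table; congr pair; apply/rowP => i;
  rewrite /lie /= /heis3_lie /zero_lie !mxE /=; ring.
Qed.

Let YaC : structure_constants Ya
  (bracket_table (table6 [:: 0; 1] [::] [::] [::] [::] [::])).
Proof.
by apply: structure_constants_table; congr pair; apply/rowP => i;
  rewrite /lie /= /aff1_lie /zero_lie !mxE /=; ring.
Qed.

Let YoC : structure_constants Yo
  (bracket_table (table6 [::] [::] [::] [::] [::] [::])).
Proof.
by apply: structure_constants_table; apply/rowP => i; rewrite !mxE /=; ring.
Qed.

(** Everything is determined by u = [X_0, X_1]. If [u] has a component on X_0 or X_1, it is an
    eigenvector of ad X_1 or ad X_0 with nonzero eigenvalue, which gives the affine case. Otherwise
    [u] is central: Heisenberg if it is nonzero, abelian if it is zero. *)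
Lemma excluded_of_central (L : lieAlgType R) (X : 4.-tuple L) :
  \dim {:L} = 4%N -> basis_of fullv X ->
  (forall x, lie X`_2 x = 0) -> (forall x, lie X`_3 x = 0) -> excluded L.
Proof.
move=> dimL XB z2 z3.
have z2' x : lie x X`_2 = 0 by rewrite lieC z2 oppr0.
have z3' x : lie x X`_3 = 0 by rewrite lieC z3 oppr0.
have tab (Z : 4.-tuple L) r : (forall x, lie Z`_2 x = 0) -> (forall x, lie Z`_3 x = 0) ->
    lie Z`_0 Z`_1 = vec4s Z r ->
    structure_constants Z (bracket_table (table6 r [::] [::] [::] [::] [::])).
  move=> c2 c3 h; have c2' x : lie x Z`_2 = 0 by rewrite lieC c2 oppr0.
  have c3' x : lie x Z`_3 = 0 by rewrite lieC c3 oppr0.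
  by apply: structure_constants_table => //; rewrite ?c2' ?c3' /vec4s /vec4 /= !scale0r !addr0.
pose u := lie X`_0 X`_1; have uE := vec4_coord u XB; move: uE.
set a := coord X _ u; set b := coord X _ u; set c := coord X _ u; set d := coord X _ u => uE.
have l0u : lie X`_0 u = b *: u.
  rewrite {1}uE /vec4 !linearDr !linearZr_LR /= liexx z2' z3' !scaler0 add0r !addr0.
  by [].
have l1u : lie X`_1 u = - a *: u.
  rewrite {1}uE /vec4 !linearDr !linearZr_LR /= liexx z2' z3' !scaler0 !addr0.
  by rewrite lieC scaleNr scalerN.
have indep p q r s t : p *: X`_0 + q *: X`_1 + r *: u + s *: X`_2 + t *: X`_3 = 0 ->
    [/\ p + r * a = 0, q + r * b = 0, r * c + s = 0 & r * d + t = 0].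
  move=> e; have E i : coord X i (p *: X`_0 + q *: X`_1 + r *: u + s *: X`_2 + t *: X`_3) = 0.
    by rewrite e linear0.
  have := E (inord 0); have := E (inord 1); have := E (inord 2); have := E (inord 3).
  rewrite !linearD !linearZ /= !coord_nth // !inordK //= -/a -/b -/c -/d.
  by rewrite !mulr0 !mulr1 !add0r !addr0.
have abs (x y : R) : x != 0 -> x * y = 0 -> y = 0.
  by move=> x0 /eqP; rewrite mulf_eq0 (negPf x0) => /eqP.
have [a0|a0] := eqVneq a 0; last first.
  right; left; pose Z := [tuple - a^-1 *: X`_1; u; X`_2; X`_3].
  have ZB : basis_of fullv Z.
    apply: basis4 => // p q r s; rewrite /vec4 /= scalerA.
    have := indep 0 (p * - a^-1) q r s; rewrite scale0r add0r => h /h[];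
      rewrite !add0r [q * a]mulrC => /(abs _ _ a0) -> /eqP.
    rewrite mul0r addr0 mulrN oppr_eq0 mulf_eq0 invr_eq0 (negPf a0) orbF => /eqP ->.
    by rewrite !mul0r !add0r.
  apply: (iso_of_constants ZB YaB) YaC; apply: tab => //=.
  rewrite linearZl_LR /= l1u scalerA mulrNN mulVf // scale1r.
  by rewrite /vec4s /vec4 /= !scale0r scale1r add0r !addr0.
have [b0|b0] := eqVneq b 0; last first.
  right; left; pose Z := [tuple b^-1 *: X`_0; u; X`_2; X`_3].
  have ZB : basis_of fullv Z.
    apply: basis4 => // p q r s; rewrite /vec4 /= scalerA.
    have := indep (p * b^-1) 0 q r s; rewrite scale0r addr0 => h /h[];
      rewrite a0 !add0r mulr0 addr0 [q * b]mulrC => /eqP + /(abs _ _ b0) ->.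
    rewrite mulf_eq0 invr_eq0 (negPf b0) orbF => /eqP ->.
    by rewrite !mul0r !add0r.
  apply: (iso_of_constants ZB YaB) YaC; apply: tab => //=.
  rewrite linearZl_LR /= l0u scalerA mulVf // scale1r.
  by rewrite /vec4s /vec4 /= !scale0r scale1r add0r !addr0.
have uc x : lie u x = 0.
  by rewrite uE a0 b0 /vec4 !scale0r !add0r linearDl !linearZl_LR /= z2 z3 !scaler0 addr0.
have [c0|c0] := eqVneq c 0; last first.
  left; pose Z := [tuple X`_0; X`_1; u; X`_3].
  have ZB : basis_of fullv Z.
    apply: basis4 => // p q r s; rewrite /vec4 /=.
    have := indep p q r 0 s; rewrite scale0r addr0 => h /h[];
      rewrite a0 b0 !mulr0 !addr0 => -> -> /eqP; rewrite mulf_eq0 (negPf c0) orbF.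
    by move/eqP => ->; rewrite mul0r add0r.
  apply: (iso_of_constants ZB YhB) YhC; apply: tab => //=.
  by rewrite /vec4s /vec4 /= !scale0r scale1r !add0r addr0.
have [d0|d0] := eqVneq d 0; last first.
  left; pose Z := [tuple X`_0; X`_1; u; X`_2].
  have ZB : basis_of fullv Z.
    apply: basis4 => // p q r s; rewrite /vec4 /=.
    have := indep p q r s 0; rewrite scale0r addr0 => h /h[];
      rewrite a0 b0 !mulr0 !addr0 => -> -> + /eqP; rewrite mulf_eq0 (negPf d0) orbF.
    by move=> + /eqP r0; rewrite r0 mul0r add0r.
  apply: (iso_of_constants ZB YhB) YhC; apply: tab => //=.
  by rewrite /vec4s /vec4 /= !scale0r scale1r !add0r addr0.
right; right; apply: (iso_of_constants XB YoB) YoC; apply: tab => //.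
by rewrite -/u uE a0 b0 c0 d0.
Qed.

End Excluded.

(** * The torsion in coordinates and its polynomial equations *)

Section Torsion.
Context {R : realType}.
Variable t : nat -> nat -> nat -> R.

(* [t i j k] stands for [w (lie e_i e_j) e_k] in a Darboux frame, and [sharp t a] for
   the coordinates of the vector [v] such that [w v y = w (lie a y) a]. *)
Definition trilin (a b c : seq R) : R :=
  \sum_(i < 4) \sum_(j < 4) \sum_(k < 4) a`_i * b`_j * c`_k * t i j k.

Definition sharp (a : seq R) : seq R :=
  let S j := \sum_(i < 4) \sum_(k < 4) a`_i * a`_k * t i j k in
  [:: S 1%N; - S 0%N; S 3%N; - S 2%N].

Definition torsion_quintic (a : seq R) : R := trilin a (sharp a) (sharp a).

(** The pairing with e_l of the Jacobi sum of e_i, e_j, e_k; inner brackets are recovered from [t]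
    by inverting the Darboux form. *)
Definition jacobiator (i j k l : nat) : R :=
  let D i j k := t j k 1%N * t i 0%N l - t j k 0%N * t i 1%N l
               + t j k 3%N * t i 2%N l - t j k 2%N * t i 3%N l in
  D i j k + D j k i + D k i j.

End Torsion.

Section PolynomialIdentities.
Context {R : realFieldType}.

(** There is no constant term, so five distinct nonzero sample points determine the coefficients. *)
Lemma quintic_eq0 (a b c d e : R) :
  (forall y, a * y + b * y ^+ 2 + c * y ^+ 3 + d * y ^+ 4 + e * y ^+ 5 = 0) ->
  [/\ a = 0, b = 0, c = 0, d = 0 & e = 0].
Proof.
move=> h; have := h 1; have := h (-1); have := h 2; have := h (-2); have := h 3.
by move=> *; split; lra.
Qed.

End PolynomialIdentities.

(** * The three families on which the quintic vanishes *)

Section FlatTables.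
Context {R : realType}.
Implicit Types p q r u : R.

Definition torsion_r4m1m1 p u : nat -> nat -> nat -> R := bracket_table (table6
  [:: 0; u; u * p; p] [:: - p ^+ 3; 0; u * p ^+ 2; 0] [:: 0; p; p ^+ 2; 0]
  [:: - (u * p); 0; u ^+ 2; 0] [:: 0; 0; 0; -1] [:: p ^+ 2; 0; - (u * p); 0]).

(** The family that contains excluded algebras: for [r = u = 0] it has two independent central
    vectors. *)
Definition torsion_reducible q r u : nat -> nat -> nat -> R := bracket_table (table6
  [:: r + q ^+ 2; u; - (u * q); - q] [:: q * r; 0; 0; - r] [:: 0; 0; 0; 0]
  [:: u * q; 0; 0; - u] [:: q; 0; 0; -1] [:: r; u; - (u * q); 0]).

Definition torsion_hyperbolic p : nat -> nat -> nat -> R := bracket_table (table6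
  [:: 10 * p ^+ 2; 0; 0; 4 * p] [:: 12 * p ^+ 3; 0; 0; 4 * p ^+ 2] [:: 0; p; 2 * p ^+ 2; 0]
  [:: 0; 0; 0; 0] [:: - (3 * p); 0; 0; -1] [:: - (2 * p ^+ 2); 0; 0; 0]).

End FlatTables.

(** * Solving the quintic and Jacobi equations in a normal frame *)

Section NormalForm.
Context {R : realType}.
(* The frame starts with [v_x] and ends with [x]; its two other vectors are chosen so
   that [t131 = t132 = 0].  Closedness of [w] gives the entries with distinct indices
   in increasing order. *)
Variables t010 t011 t020 t021 t022 t031 t032 t120 t121 t122 t130 t230 t231 t232 : R.

Let t : nat -> nat -> nat -> R := bracket_table (table6
  [:: t010; t011; t021 - t120; t031 - t130] [:: t020; t021; t022; t032 - t230]
  [:: 0; t031; t032; 0] [:: t120; t121; t122; - t231] [:: t130; 0; 0; -1]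
  [:: t230; t231; t232; 0]).

(** Covers the lines e_3 + y e_1 and e_3 + y e_2 at once, so that N on either of them is obtained by
    substitution. *)
Let trilin_self y z v0 v1 v2 v3 :
  trilin t [:: 0; y; z; 1] [:: v0; v1; v2; v3] [:: v0; v1; v2; v3] =
    y * (- t010 * v0 ^+ 2 - t011 * v0 * v1 - (t021 - 2 * t120) * v0 * v2
         - (t031 - 2 * t130) * v0 * v3 + t121 * v1 * v2 + t122 * v2 ^+ 2
         - t231 * v2 * v3 - v3 ^+ 2)
  + z * (- t020 * v0 ^+ 2 - (t021 + t120) * v0 * v1 - t022 * v0 * v2
         - (t032 - 2 * t230) * v0 * v3 - t121 * v1 ^+ 2 - t122 * v1 * v2
         + 2 * t231 * v1 * v3 + t232 * v2 * v3)
  - (t031 + t130) * v0 * v1 - (t032 + t230) * v0 * v2 + v1 * v3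
  - t231 * v1 * v2 - t232 * v2 ^+ 2.
Proof.
rewrite /trilin !big_ord_recl !big_ord0 /t /bracket_table /=.
rewrite ?(mul0r, mul1r, add0r, addr0, subr0, sub0r, mulr0).
by ring.
Qed.

(** Along e_3 + y e_1 the quintic is a polynomial in [y] all of whose coefficients vanish; the top
    one is [- t121 ^+ 2]. *)
Lemma flat_line1 : (forall y, torsion_quintic t [:: 0; y; 0; 1] = 0) ->
  [/\ t121 = 0, t122 = t011 ^+ 2 - 3 * t011 * t231 + 2 * t231 ^+ 2,
      t010 = t032 + t230 - t031 * t130 - 2 * t031 ^+ 2 + t130 ^+ 2
    & t021 - 2 * t120 - t232 - 3 * t011 * t031 + 4 * t031 * t231 + t130 * t231 = 0].
Proof.
move=> h; have [] := @quintic_eq0 _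
  (- t010 + t032 + t230 - t031 * t130 - 2 * t031 ^+ 2 + t130 ^+ 2)
  (t021 - 2 * t120 - t232 - 3 * t011 * t031 + 4 * t031 * t231 + t130 * t231)
  (t122 + 3 * t011 * t231 - t011 ^+ 2 - 3 * t031 * t121 - 2 * t231 ^+ 2)
  (- 2 * t011 * t121 + 3 * t121 * t231) (- t121 ^+ 2).
  move=> y; rewrite -[RHS](h y) /torsion_quintic.
  have -> : sharp t [:: 0; y; 0; 1]
      = [:: 1; t011 * y ^+ 2 + (2 * t031 - t130) * y; - y; 2 * t231 * y - t121 * y ^+ 2].
    rewrite /sharp /= !big_ord_recl !big_ord0 /t /bracket_table /=.
    by congr [:: _; _; _; _]; ring.
  rewrite trilin_self; ring.
move=> e1 e2 e3 _ /eqP; rewrite oppr_eq0 expf_eq0 /= => /eqP z.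
by rewrite z in e3 *; split=> //; lra.
Qed.
(** Along e_3 + y e_2 the linear coefficient determines [t020]. *)
Lemma flat_line2 : (forall y, torsion_quintic t [:: 0; 0; y; 1] = 0) ->
  t020 = - 2 * t031 * t032 + t031 * t230 - 2 * t032 * t130 + t130 * t230.
Proof.
move=> h; have [] := @quintic_eq0 _
  (- 2 * t031 * t032 + t031 * t230 - t020 - 2 * t032 * t130 + t130 * t230)
  (- 2 * t021 * t032 + t021 * t230 - 2 * t031 * t032 * t231
    + t031 * t230 * t231 - t022 * t031 - 2 * t020 * t231 - 2 * t032 * t120
    + t120 * t230 - 2 * t032 * t130 * t231 + t130 * t230 * t231 - t022 * t130)
  (- 2 * t021 * t032 * t231 + t021 * t230 * t231 - t021 * t022 - 4 * t032 ^+ 2 * t121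
    + 4 * t032 * t121 * t230 - t121 * t230 ^+ 2 - t022 * t031 * t231
    + 2 * t031 * t032 * t122 - t031 * t122 * t230 - t020 * t231 ^+ 2
    + 2 * t020 * t122 - 2 * t032 * t120 * t231 + t120 * t230 * t231 - t022 * t120
    + 2 * t032 * t122 * t130 - t122 * t130 * t230 - t022 * t130 * t231)
  (- t021 * t022 * t231 + 2 * t021 * t032 * t122 - t021 * t122 * t230 - 4 * t022 * t032 * t121
    + 2 * t022 * t121 * t230 + t022 * t031 * t122 + 2 * t020 * t122 * t231
    + 2 * t032 * t120 * t122 - t120 * t122 * t230 - t022 * t120 * t231 + t022 * t122 * t130)
  (t021 * t022 * t122 - t022 ^+ 2 * t121 - t020 * t122 ^+ 2 + t022 * t120 * t122).
  move=> z; rewrite -[RHS](h z) /torsion_quintic.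
  have -> : sharp t [:: 0; 0; z; 1]
      = [:: 1 + t231 * z - t122 * z ^+ 2; t022 * z ^+ 2 + (2 * t032 - t230) * z;
            t232 * z ^+ 2; t232 * z].
    rewrite /sharp /= !big_ord_recl !big_ord0 /t /bracket_table /=.
    by congr [:: _; _; _; _]; ring.
  rewrite trilin_self; ring.
by move=> e _ _ _ _; lra.
Qed.

(** All entries are expressed through five parameters, on which the remaining Jacobi identities
    impose equations that partly factor. For [p != 0], either [q = 0] or [q = - 3 p]; for [p = 0],
    either [w = u] or [w], [q] and [r] vanish. *)
Lemma flat_normal_form :
  (forall y, torsion_quintic t [:: 0; y; 0; 1] = 0) ->
  (forall y, torsion_quintic t [:: 0; 0; y; 1] = 0) ->
  (forall i j k l, (i < 4)%N -> (j < 4)%N -> (k < 4)%N -> (l < 4)%N -> jacobiator t i j k l = 0) ->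
  [\/ exists2 p, p != 0 & t = torsion_hyperbolic p,
      exists p u, (p != 0) || (u != 0) /\ t = torsion_r4m1m1 p u
    | exists q r u, t = torsion_reducible q r u].
Proof.
move=> /flat_line1[h121 h122 h010 hx] /flat_line2 h020 J.
have := J 0%N 1%N 3%N 1%N isT isT isT isT; have := J 1%N 2%N 3%N 3%N isT isT isT isT.
have := J 0%N 1%N 3%N 3%N isT isT isT isT; have := J 0%N 1%N 3%N 2%N isT isT isT isT.
have := J 1%N 2%N 3%N 1%N isT isT isT isT; have := J 0%N 1%N 3%N 0%N isT isT isT isT.
have := J 0%N 2%N 3%N 3%N isT isT isT isT; have := J 0%N 1%N 2%N 1%N isT isT isT isT.
have := J 1%N 2%N 3%N 0%N isT isT isT isT; have := J 0%N 2%N 3%N 1%N isT isT isT isT.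
rewrite {J} /jacobiator /t /bracket_table /=.
rewrite ?(mul0r, mul1r, add0r, addr0, subr0, sub0r, mulr0).
move=> J8 J13 J0 J10 J5 J12 J7 J6 J14 J4.
move: h121 h122 h010 h020 hx J8 J13 J0 J10 J5 J12 J7 J6 J14 J4.
(* The five free parameters. The next five equations use that the identities are linear in the other
   entries once products are treated as atoms. *)
move: t031 t130 t011 t231 t230 => p q u w r.
move=> h121 h122 h010 h020 hx J8 J13 J0 J10 J5 J12 J7 J6 J14 J4.
have h021 : t021 = - u * q - p * w + q * w by lra.
have h120 : t120 = t232 - p * w + 2 * q * w by lra.
have h232 : t232 = - u * p - u * q / 3 + 5 / 3 * p * w - 2 / 3 * q * w by lra.
have h032 : t032 = p ^+ 2 - p * q / 3 by lra.
have h022 : t022 = - u * t032 + t021 * p - t021 * q - t120 * p - p * t232 + t120 * q + q * t232.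
  by lra.
(* What remains of the Jacobi identities after substitution; the factored ones direct the case
   analysis. *)
have K12 : w * (w - u) = 0 by rewrite ?h121 ?h122 ?h010 ?h020 ?h021 ?h120 ?h232 ?h032 in J12; lra.
have K5 : p * (r - p * q - p ^+ 2) = 0 by rewrite ?h121 ?h122 ?h010 ?h020 ?h021 ?h120 ?h232 ?h032 in J5; lra.
have K10 : p * q * (q + 3 * p) = 0 by rewrite ?h121 ?h122 ?h010 ?h020 ?h021 ?h120 ?h232 ?h032 in J10; lra.
have K0 : 4 * u * p * w + u * q * w + u ^+ 2 * q + 2 * p * w ^+ 2 - 2 * q * w ^+ 2 = 0.
  by rewrite ?h121 ?h122 ?h010 ?h020 ?h021 ?h120 ?h232 ?h032 in J0; lra.
have K13 : - 3 * u * p * q - u * q ^+ 2 + p * q * w - 3 * p ^+ 2 * w + q ^+ 2 * w = 0.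
  by rewrite ?h121 ?h122 ?h010 ?h020 ?h021 ?h120 ?h232 ?h032 in J13; lra.
have K8 : - 3 * u * r + 3 * r * w + u * p * q + 3 * u * p ^+ 2 + 2 * p * q * w - 5 * p ^+ 2 * w = 0.
  by rewrite ?h121 ?h122 ?h010 ?h020 ?h021 ?h120 ?h232 ?h032 in J8; lra.
clear J8 J13 J0 J10 J5 J12 J7 J6 J14 J4.
have cancel (x y : R) : x != 0 -> x * y = 0 -> y = 0.
  by move=> x0 /eqP; rewrite mulf_eq0 (negPf x0) => /eqP.
have [p0|p0] := eqVneq p 0; last first.
  have hr : r = p * q + p ^+ 2 by have := cancel _ _ p0 K5; lra.
  have [q0|q0] := eqVneq q 0.
    have w0 : w = 0.
      apply/eqP/negPn/negP => w0; have uw : u = w by have := cancel _ _ w0 K12; lra.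
      have : (6 * p * w) * w = 0 by move: K0; rewrite q0 uw; lra.
      by move/eqP; rewrite !mulf_eq0 (negPf p0) (negPf w0) pnatr_eq0.
    constructor 2; exists p, u; rewrite p0; split=> //.
    rewrite /torsion_r4m1m1; subst q w; congr (bracket_table (table6 _ _ _ _ _ _));
      by congr [:: _; _; _; _]; rewrite ?h121 ?h122 ?h010 ?h020 ?h022 ?h021 ?h120 ?h232 ?h032 ?hr; field.
  have q3 : q = - (3 * p) by have := cancel _ _ (mulf_neq0 p0 q0) K10; lra.
  have w0 : w = 0.
    by apply: (cancel _ _ (mulf_neq0 p0 p0)); move: K13; rewrite q3; lra.
  have u0 : u = 0.
    by apply: (cancel _ _ (mulf_neq0 p0 p0)); move: K8; rewrite hr q3 w0; lra.
  constructor 1; exists p => //.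
  rewrite /torsion_hyperbolic; subst w u; congr (bracket_table (table6 _ _ _ _ _ _));
    by congr [:: _; _; _; _]; rewrite ?h121 ?h122 ?h010 ?h020 ?h022 ?h021 ?h120 ?h232 ?h032 ?hr ?q3; field.
have [uw|uw] := eqVneq w u.
  constructor 3; exists q, r, u.
  rewrite /torsion_reducible; subst p w; congr (bracket_table (table6 _ _ _ _ _ _));
    by congr [:: _; _; _; _]; rewrite ?h121 ?h122 ?h010 ?h020 ?h022 ?h021 ?h120 ?h232 ?h032; field.
have uw' : w - u != 0 by rewrite subr_eq0.
have w0 : w = 0 by apply: (cancel _ _ uw'); rewrite mulrC.
have q0 : q = 0.
  apply/eqP; rewrite -sqrf_eq0; apply/eqP/(cancel _ _ uw'); move: K13; rewrite p0; lra.
have r0 : r = 0 by apply: (cancel _ _ uw'); move: K8; rewrite p0; lra.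
constructor 2; exists p, u; split; first by apply/orP; right; rewrite -w0 eq_sym.
rewrite /torsion_r4m1m1; subst p q w r; congr (bracket_table (table6 _ _ _ _ _ _));
  by congr [:: _; _; _; _]; rewrite ?h121 ?h122 ?h010 ?h020 ?h022 ?h021 ?h120 ?h232 ?h032; field.
Qed.

End NormalForm.

(** * Brackets and forms expanded in a Darboux frame *)

Section Expansions.
Context {R : realType} {L : lieAlgType R}.
Variables (w : {skew_symmetric L}) (I : finType) (a : I -> R) (v : I -> L).

Lemma lie_suml z : lie (\sum_i a i *: v i) z = \sum_i a i *: lie (v i) z.
Proof. by rewrite linear_sumlz; apply: eq_bigr => i _; rewrite linearZl_LR. Qed.

Lemma lie_sumr z : lie z (\sum_i a i *: v i) = \sum_i a i *: lie z (v i).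
Proof. by rewrite linear_sumr; apply: eq_bigr => i _; rewrite linearZr_LR. Qed.

Lemma form_suml z : w (\sum_i a i *: v i) z = \sum_i a i * w (v i) z.
Proof. by rewrite linear_sumlz; apply: eq_bigr => i _; rewrite linearZl_LR. Qed.

Lemma form_sumr z : w z (\sum_i a i *: v i) = \sum_i a i * w z (v i).
Proof. by rewrite linear_sumr; apply: eq_bigr => i _; rewrite linearZr_LR. Qed.

End Expansions.

Section TorsionOfBasis.
Context {R : realType} {L : lieAlgType R}.
Variables (w : {skew_symmetric L}) (X : 4.-tuple L).
Hypotheses (XB : basis_of fullv X) (wX : darboux w X).
Variable t : nat -> nat -> nat -> R.
Hypothesis tX : forall i j k : 'I_4, w (lie X`_i X`_j) X`_k = t i j k.

Definition comb (a : seq R) : L := \sum_(i < 4) a`_i *: X`_i.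

Lemma combE a : comb a = vec4s X a.
Proof. by rewrite /comb (sum4 (fun i => a`_i *: X`_i)). Qed.

Lemma darboux_std x y : w x y = std_form X x y.
Proof.
by case: wX => -[w01 w23 w02 w03] [w12 w13]; rewrite (std_form_scaled (l := 1) XB) ?mul1r.
Qed.

(** A Darboux frame is dual to itself under [w], up to order and signs. *)
Lemma darboux_coord x :
  x = comb [:: w x X`_1; - w x X`_0; w x X`_3; - w x X`_2].
Proof.
rewrite {1}(vec4_coord x XB) combE /vec4s /= !darboux_std /std_form !coord_nth //.
by rewrite !inordK //=; congr vec4; ring.
Qed.

Lemma form_comb a b : w (comb a) (comb b)
  = a`_0 * b`_1 - a`_1 * b`_0 + a`_2 * b`_3 - a`_3 * b`_2.
Proof.
rewrite darboux_std /std_form !combE /vec4s.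
have [-> -> -> ->] := coord_vec4 a`_0 a`_1 a`_2 a`_3 XB.
by have [-> -> -> ->] := coord_vec4 b`_0 b`_1 b`_2 b`_3 XB.
Qed.

Lemma trilin_comb a b c :
  w (lie (comb a) (comb b)) (comb c) = trilin t a b c.
Proof.
rewrite /comb /trilin lie_suml form_suml; apply: eq_bigr => i _.
rewrite lie_sumr form_suml mulr_sumr; apply: eq_bigr => j _.
rewrite form_sumr !mulr_sumr; apply: eq_bigr => k _.
by rewrite tX; ring.
Qed.

(** Antisymmetry reduces the double sum to six 2 x 2 minors; with the sums written out, brackets of
    explicit vectors are within reach of [ring] and [field]. *)
Lemma lie_comb a b (m := fun i j : nat => a`_i * b`_j - a`_j * b`_i)
  (D := fun k : nat => m 0%N 1%N * t 0%N 1%N k + m 0%N 2%N * t 0%N 2%N k + m 0%N 3%N * t 0%N 3%N k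
      + m 1%N 2%N * t 1%N 2%N k + m 1%N 3%N * t 1%N 3%N k + m 2%N 3%N * t 2%N 3%N k) :
  lie (comb a) (comb b) = comb [:: D 1%N; - D 0%N; D 3%N; - D 2%N].
Proof.
have tC i j k : (i < 4)%N -> (j < 4)%N -> (k < 4)%N -> t i j k = - t j i k.
  move=> i4 j4 k4; rewrite -(tX (Ordinal i4) (Ordinal j4) (Ordinal k4)).
  by rewrite -(tX (Ordinal j4) (Ordinal i4) (Ordinal k4)) lieC linearNl.
have E k : (k < 4)%N -> w (lie (comb a) (comb b)) X`_k = D k.
  move=> k4; transitivity (\sum_(i < 4) \sum_(j < 4) a`_i * b`_j * t i j k).
    rewrite /comb lie_suml form_suml; apply: eq_bigr => i _.
    rewrite lie_sumr form_suml mulr_sumr; apply: eq_bigr => j _.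
    by rewrite (tX i j (Ordinal k4)) /=; ring.
  have t0 i : (i < 4)%N -> t i i k = 0 by move=> i4; have := tC i i k i4 i4 k4; lra.
  rewrite !big_ord_recl !big_ord0 /bump /= !t0 // (tC 1%N 0%N) // (tC 2%N 0%N) //.
  rewrite (tC 3%N 0%N) // (tC 2%N 1%N) // (tC 3%N 1%N) // (tC 3%N 2%N) // /D /m.
  by ring.
by rewrite [LHS]darboux_coord !E.
Qed.

Lemma sharp_comb a y : w (comb (sharp t a)) y = w (lie (comb a) y) (comb a).
Proof.
rewrite [y in RHS](coord_basis XB (memvf y)) [y in LHS](coord_basis XB (memvf y)).
rewrite lie_sumr form_suml form_sumr; apply: eq_bigr => j _; congr (_ * _).
have -> : w (lie (comb a) X`_j) (comb a) = \sum_(i < 4) \sum_(k < 4) a`_i * a`_k * t i j k.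
  rewrite /comb lie_suml form_suml; apply: eq_bigr => i _.
  by rewrite form_sumr mulr_sumr; apply: eq_bigr => k _; rewrite tX; ring.
have -> : X`_j = comb [seq (j == k :> nat)%:R | k <- iota 0 4].
  by case: j => -[|[|[|[|]]]] // j4; rewrite combE /vec4s /vec4 /= ?scale0r ?scale1r ?add0r ?addr0.
by rewrite form_comb /sharp; case: j => -[|[|[|[|]]]] // j4 /=; ring.
Qed.

Lemma jacobiator_eq0 i j k l :
  (i < 4)%N -> (j < 4)%N -> (k < 4)%N -> (l < 4)%N -> jacobiator t i j k l = 0.
Proof.
move=> i4 j4 k4 l4; have := congr1 (w^~ X`_l) (lie_jacobi X`_i X`_j X`_k).
rewrite linear0l !linearDl /= => J; rewrite -[RHS]J /jacobiator.
have E i' j' k' : (i' < 4)%N -> (j' < 4)%N -> (k' < 4)%N ->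
   w (lie X`_i' (lie X`_j' X`_k')) X`_l = t j' k' 1%N * t i' 0%N l - t j' k' 0%N * t i' 1%N l
               + t j' k' 3%N * t i' 2%N l - t j' k' 2%N * t i' 3%N l.
  move=> hi hj hk.
  have tX' p q s : (p < 4)%N -> (q < 4)%N -> (s < 4)%N -> w (lie X`_p X`_q) X`_s = t p q s.
    by move=> hp hq hs; rewrite (tX (Ordinal hp) (Ordinal hq) (Ordinal hs)).
  rewrite [lie X`_j' _]darboux_coord combE /vec4s /vec4 /= !tX' //.
  rewrite !linearDr !linearDl /= !linearZr_LR /= !linearZl_LR /= !tX' //.
  by ring.
by rewrite !E.
Qed.

End TorsionOfBasis.

(** * The families reduced to the two explicit algebras *)

Section Branches.
Context {R : realType} {L : lieAlgType R}.
Hypothesis dimL : \dim {:L} = 4%N.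

Lemma combP (X : 4.-tuple L) k a b :
  k *: comb X a + comb X b
    = comb X [:: k * a`_0 + b`_0; k * a`_1 + b`_1; k * a`_2 + b`_2; k * a`_3 + b`_3].
Proof. by rewrite !combE /vec4s vec4_linear. Qed.

Lemma comb0 (X : 4.-tuple L) : comb X [::] = 0.
Proof. by rewrite /comb big1 // => i _; rewrite nth_nil scale0r. Qed.

Lemma combZ (X : 4.-tuple L) k a :
  k *: comb X a = comb X [:: k * a`_0; k * a`_1; k * a`_2; k * a`_3].
Proof. by rewrite -[LHS]addr0 -(comb0 X) combP !nth_nil !addr0. Qed.

Lemma combD (X : 4.-tuple L) a b :
  comb X a + comb X b = comb X [:: a`_0 + b`_0; a`_1 + b`_1; a`_2 + b`_2; a`_3 + b`_3].
Proof. by rewrite -[X in X + _]scale1r combP !mul1r. Qed.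

Lemma basis_of_comb (X : 4.-tuple L) A B C D : basis_of fullv X ->
  (forall a b c d, let F k := a * A`_k + b * B`_k + c * C`_k + d * D`_k in
     F 0%N = 0 -> F 1%N = 0 -> F 2%N = 0 -> F 3%N = 0 -> [/\ a = 0, b = 0, c = 0 & d = 0]) ->
  basis_of fullv [tuple comb X A; comb X B; comb X C; comb X D].
Proof.
move=> XB h; apply: basis4 => // a b c d; rewrite /vec4 /= !combZ !combD /= combE.
by case/(vec4_eq0 XB); exact: h.
Qed.

Variables (w : {skew_symmetric L}) (X : 4.-tuple L).
Hypotheses (XB : basis_of fullv X) (wX : darboux w X).

Lemma ricci13_of_torsion_hyperbolic p : p != 0 ->
  (forall i j k : 'I_4, w (lie X`_i X`_j) X`_k = torsion_hyperbolic p i j k) -> admits_ricci13 L.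
Proof.
move=> p0 tX.
(* A frame with the brackets of [ricci13_of_complex_hyperbolic]. It need not be Darboux for [w]: the
   resulting almost-Kähler structure has its own symplectic form. *)
pose A := [:: 1; 0; 0; - (2 * p)].
pose B := [:: 0; 8 * p ^+ 3 - p; 1 - 4 * p ^+ 2; 0].
pose C := [:: 0; - (2 * p ^+ 3); p ^+ 2; 0].
pose D := [:: 0; 0; 0; p^-1].
have cancel (x y : R) : x != 0 -> x * y = 0 -> y = 0.
  by move=> x0 /eqP; rewrite mulf_eq0 (negPf x0) => /eqP.
have YB : basis_of fullv [tuple comb X A; comb X B; comb X C; comb X D].
  apply: basis_of_comb => // a b c d /=; rewrite !mulr0 !mulr1 !addr0 !add0r => a0 h1 h2 h3.
  have b0 : b = 0.
    apply: (cancel _ _ p0); move: h1 h2; set x := _ + _ => x0; set y := _ + _ => y0.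
    by transitivity (x + 2 * p * y); [rewrite /x /y; ring | rewrite x0 y0 mulr0 addr0].
  have c0 : c = 0 by apply: (cancel _ _ (mulf_neq0 p0 p0)); move: h2; rewrite b0; lra.
  split=> //; apply: (cancel _ _ (_ : p^-1 != 0)); first by rewrite invr_eq0.
  by move: h3; rewrite a0; lra.
apply: (ricci13_of_complex_hyperbolic YB) => //=;
  rewrite (lie_comb XB wX tX) -?scaleNr ?combZ ?combD -?(comb0 X) !combE /vec4s;
  congr vec4; rewrite /torsion_hyperbolic /bracket_table /=; by field.
Qed.

Lemma ricci13_of_torsion_r4m1m1 p u : (p != 0) || (u != 0) ->
  (forall i j k : 'I_4, w (lie X`_i X`_j) X`_k = torsion_r4m1m1 p u i j k) -> admits_ricci13 L.
Proof.
move=> pu tX.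
(* Over the reals this sum of squares vanishes only for [p = u = 0]; it is the denominator in
   [C]. *)
have d0 : p ^+ 2 + u ^+ 2 != 0.
  rewrite paddr_eq0 ?sqr_ge0 // !sqrf_eq0 negb_and.
  exact: pu.
have cancel (x y : R) : x != 0 -> x * y = 0 -> y = 0.
  by move=> x0 /eqP; rewrite mulf_eq0 (negPf x0) => /eqP.
pose d := p ^+ 2 + u ^+ 2.
pose A := [:: 0; p; 1; - u].
pose B := [:: 0; 0; 2; 0] : seq R.
pose C := [:: 0; - (u / d); 0; - (p / d)].
pose D := [:: 1; 0; 0; - p].
have YB : basis_of fullv [tuple comb X A; comb X B; comb X C; comb X D].
  apply: basis_of_comb => // a b c e /=; rewrite !mulr0 !mulr1 !addr0 !add0r => h0 h1 h2 h3.
  have e0 : e = 0 by [].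
  have a0 : a = 0.
    apply: (cancel _ _ d0); transitivity (p * (a * p + c * - (u / d))
      - u * (a * - u + c * - (p / d) + e * - p)).
      by rewrite e0; ring.
    by rewrite h1 h3 !mulr0 subr0.
  have b0 : b = 0 by move: h2; rewrite a0; lra.
  split=> //; apply: (cancel d^-1); first by rewrite invr_eq0.
  transitivity (- (u * (a * p + c * - (u / d)) + p * (a * - u + c * - (p / d) + e * - p)) / d).
    by rewrite a0 e0 /d; field.
  by rewrite h1 h3 !mulr0 addr0 oppr0 mul0r.
apply: (ricci13_of_r4m1m1 YB) => //=;
  rewrite (lie_comb XB wX tX) -?scaleNr ?combZ -?scaleN1r ?combZ ?combD -?(comb0 X) !combE /vec4s;
  congr vec4; rewrite /torsion_r4m1m1 /bracket_table /= /d; by field.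
Qed.


End Branches.

(** * The remaining family, by a change of symplectic form *)

Section Reducible.
Context {R : realType} {L : lieAlgType R}.
Hypothesis dimL : \dim {:L} = 4%N.
Hypothesis flat : forall (w : {skew_symmetric L}) x v, is_symplectic_form w ->
  (forall y, w v y = w (lie x y) x) -> w (lie x v) v = 0.

Lemma flat_quintic (w : {skew_symmetric L}) (X : 4.-tuple L) (t : nat -> nat -> nat -> R) a :
  is_symplectic_form w -> basis_of fullv X -> darboux w X ->
  (forall i j k : 'I_4, w (lie X`_i X`_j) X`_k = t i j k) -> torsion_quintic t a = 0.
Proof.
move=> ws XB wX tX; rewrite /torsion_quintic -(trilin_comb tX); apply: flat => // y.
by rewrite (sharp_comb XB wX tX).
Qed.

Lemma darboux_std_skew (X : 4.-tuple L) (XB : basis_of fullv X) : darboux (std_skew X) X.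
Proof.
by rewrite /darboux /= /std_form !coord_nth // !inordK //=; do !split; ring.
Qed.

Variables (w : {skew_symmetric L}) (X : 4.-tuple L).
Hypotheses (XB : basis_of fullv X) (wX : darboux w X).
Variables q r u : R.
Hypothesis tX : forall i j k : 'I_4, w (lie X`_i X`_j) X`_k = torsion_reducible q r u i j k.

Lemma excluded_of_torsion_reducible : excluded L.
Proof.
(* The frame [Y] is a Darboux frame of [w] plus the product of the closed 1-forms
   [r e^0 + u e^1 - q u e^2] and [e^3 - q e^0]. *)
pose A := [:: 1; - (q * r); - r; q].
pose B := [:: 0; 1 - q * u; - u; 0].
pose C := [:: 0; q; 1; 0].
pose D := [:: 0; 0; 0; 1] : seq R.
have YB : basis_of fullv [tuple comb X A; comb X B; comb X C; comb X D].
  apply: basis_of_comb => // a b c d /=; rewrite !mulr0 !mulr1 !addr0 ?add0r => a0 h1 h2 h3.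
  have b0 : b = 0.
    move: h1 h2; set x := _ + _ => x0; set y := _ + _ => y0.
    by transitivity (x - q * y); [rewrite /x /y a0; ring | rewrite x0 y0 mulr0 subr0].
  by move: h1 h2 h3; rewrite a0 b0 !mul0r !add0r => _ c0 d0.
set Y := [tuple _; _; _; _] in YB.
pose t := table6 [:: u; - r; 0; 0] [:: 0; 0; - r; 0] [:: - (r * u); r ^+ 2; q * r; 0]
  [:: 0; 0; - u; 0] [:: - u ^+ 2; u * r; q * u - 1; 0] [:: u; - r; - q; 0].
have cY : structure_constants Y (bracket_table t).
  by apply: structure_constants_table; rewrite /= (lie_comb XB wX tX) /vec4s /vec4 /=
    !combZ !combD /= !combE /vec4s; congr vec4; rewrite /torsion_reducible /bracket_table /=; ring.
have Ys : is_symplectic_form (std_skew Y).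
  split; first exact: std_form_nondegenerate.
  apply: (closed_std_form YB cY) => i j k.
  by case: i => [|[|[|[|]]]] //; case: j => [|[|[|[|]]]] //; case: k => [|[|[|[|]]]] // _ _ _;
    rewrite /std_torsion /bracket_table /t /=; ring.
have Yd := darboux_std_skew YB.
have tY (i j k : 'I_4) : std_skew Y (lie Y`_i Y`_j) Y`_k = std_torsion (bracket_table t) i j k.
  exact: std_form_lie.
have N x v : (forall y, std_skew Y (comb Y v) (comb Y y)
                  = std_skew Y (lie (comb Y x) (comb Y y)) (comb Y x)) ->
    std_skew Y (lie (comb Y x) (comb Y v)) (comb Y v) = 0.
  move=> h; apply: flat => // y.
  by rewrite (darboux_coord YB Yd y) h.
(* For the new form, N at the last frame vector is [r ^+ 2]; the second list is the corresponding
   v_x. *)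
have r0 : r = 0.
  apply/eqP; rewrite -sqrf_eq0; apply/eqP.
  rewrite -[RHS](N [:: 0; 0; 0; 1] [:: 1 - q * u; q * r; 0; - q]) => [|y].
    rewrite (lie_comb YB Yd tY) (form_comb YB Yd) /std_torsion /bracket_table /t /=.
    by ring.
  rewrite (lie_comb YB Yd tY) !(form_comb YB Yd) /std_torsion /bracket_table /t /=.
  by ring.
(* With [r = 0], N at e_1 + u e_2 + y e_3 is the left-hand side of [M]. If [u] were nonzero, [y = 1]
   and [y = -1] would give [u = q] and [u = - q]. *)
have u0 : u = 0.
  have M y : u ^+ 2 * y * (u - q * y) ^+ 2 = 0.
    rewrite -[RHS](N [:: 0; 1; u; y]
      [:: 2 * y * u ^+ 2 + y ^+ 2 * (1 - q * u); u; - y; 2 * y * u - y ^+ 2 * q]) => [|z].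
      rewrite (lie_comb YB Yd tY) (form_comb YB Yd) /std_torsion /bracket_table /t r0 /=.
      by ring.
    rewrite (lie_comb YB Yd tY) !(form_comb YB Yd) /std_torsion /bracket_table /t r0 /=.
    by ring.
  apply/eqP/negPn/negP => u0.
  have M' y : y != 0 -> u - q * y = 0.
    move=> y0; have /eqP := M y; rewrite mulf_eq0 mulf_eq0 !expf_eq0 /=.
    by rewrite (negPf u0) (negPf y0) => /eqP.
  have h1 := M' 1 (oner_neq0 _); have h2 : u - q * -1 = 0.
    by apply: M'; rewrite oppr_eq0 oner_eq0.
  by case/eqP: u0; lra.
(* Now the last two vectors of [Z] are central. *)
pose Z := [tuple comb X [:: 0; 1; 0; 0]; comb X [:: 0; 0; 0; 1];
                 comb X [:: 1; 0; 0; q]; comb X [:: 0; 0; 1; 0]].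
have ZB : basis_of fullv Z.
  apply: basis_of_comb => // a b c d /=; rewrite !mulr0 !mulr1 !addr0 !add0r => h0 h1 h2 h3.
  by move: h3; rewrite h0 mul0r addr0.
by apply: (excluded_of_central dimL ZB) => x /=; rewrite (darboux_coord XB wX x)
    (lie_comb XB wX tX) -(comb0 X) !combE /vec4s; congr vec4;
  rewrite /torsion_reducible /bracket_table r0 u0 /=; ring.
Qed.

End Reducible.

(** * Torsion of closed forms and the pure-trace case *)

Section FormLieComb.
Context {R : realType} {L : lieAlgType R}.
Variables (w : {skew_symmetric L}) (X : 4.-tuple L).
Hypotheses (XB : basis_of fullv X) (wX : darboux w X).
Variable t : nat -> nat -> nat -> R.
Hypothesis tX : forall i j k : 'I_4, w (lie X`_i X`_j) X`_k = t i j k.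

Lemma form_lie_comb a b c (m := fun i j : nat => a`_i * b`_j - a`_j * b`_i)
    (T := fun i j : nat => t i j 0%N * c`_0 + t i j 1%N * c`_1 + t i j 2%N * c`_2 + t i j 3%N * c`_3) :
  w (lie (comb X a) (comb X b)) (comb X c)
  = m 0%N 1%N * T 0%N 1%N + m 0%N 2%N * T 0%N 2%N + m 0%N 3%N * T 0%N 3%N
    + m 1%N 2%N * T 1%N 2%N + m 1%N 3%N * T 1%N 3%N + m 2%N 3%N * T 2%N 3%N.
Proof. by rewrite (lie_comb XB wX tX) (form_comb XB wX) /= /T /m; ring. Qed.

End FormLieComb.

Section Frames.
Context {R : realType} {L : lieAlgType R}.
Hypothesis dimL : \dim {:L} = 4%N.
Variable w : {skew_symmetric L}.
Hypothesis ws : is_symplectic_form w.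

Definition torsion (X : 4.-tuple L) (i j k : nat) : R := w (lie X`_i X`_j) X`_k.

(** Closedness and antisymmetry give t_abc = t_acb - t_bca, which eliminates the entries with
    increasing indices. *)
Lemma torsion_table (X : 4.-tuple L) (i j k : 'I_4) :
  w (lie X`_i X`_j) X`_k = bracket_table (table6
    [:: torsion X 0%N 1%N 0%N; torsion X 0%N 1%N 1%N;
      torsion X 0%N 2%N 1%N - torsion X 1%N 2%N 0%N; torsion X 0%N 3%N 1%N - torsion X 1%N 3%N 0%N]
    [:: torsion X 0%N 2%N 0%N; torsion X 0%N 2%N 1%N; torsion X 0%N 2%N 2%N;
      torsion X 0%N 3%N 2%N - torsion X 2%N 3%N 0%N]
    [:: torsion X 0%N 3%N 0%N; torsion X 0%N 3%N 1%N; torsion X 0%N 3%N 2%N; torsion X 0%N 3%N 3%N]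
    [:: torsion X 1%N 2%N 0%N; torsion X 1%N 2%N 1%N; torsion X 1%N 2%N 2%N;
      torsion X 1%N 3%N 2%N - torsion X 2%N 3%N 1%N]
    [:: torsion X 1%N 3%N 0%N; torsion X 1%N 3%N 1%N; torsion X 1%N 3%N 2%N; torsion X 1%N 3%N 3%N]
    [:: torsion X 2%N 3%N 0%N; torsion X 2%N 3%N 1%N; torsion X 2%N 3%N 2%N;
      torsion X 2%N 3%N 3%N]) i j k.
Proof.
pose t := torsion X.
have tC a b c : t a b c = - t b a c by rewrite /t /torsion lieC linearNl.
have tt a c : t a a c = 0 by rewrite /t /torsion liexx linear0l.
have cyc a b c : t a b c = t a c b - t b c a.
  have := ws.2 X`_a X`_b X`_c; rewrite -/(torsion X a b c) -/(torsion X b c a) -/(torsion X c a b).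
  by rewrite -/t (tC c a) => h; lra.
rewrite -[LHS]/(t i j k) -/t /bracket_table.
case: i => -[|[|[|[|]]]] //= ?; case: j => -[|[|[|[|]]]] //= ?;
  case: k => -[|[|[|[|]]]] //= ?; rewrite ?tt ?subr0 ?sub0r ?oppr0 //;
  first [by rewrite cyc | by rewrite tC | by rewrite tC cyc].
Qed.

(** Start from [v] and [y] with [w v y = 1]; [pr] projects onto their symplectic complement. A
    nonzero projection spans with [v] an isotropic plane, to be extended; if there were none, [v]
    and [y] would span a space of dimension four. *)
Lemma darboux_exists : exists X : 4.-tuple L, darboux w X.
Proof.
have [wnd _] := ws.
have v0 : vpick {:L} != 0 by rewrite vpick0 -dimv_eq0 dimL.
move: (vpick {:L}) v0 => v v0.
have [y' wvy'] := nondegenerate_witness wnd v0.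
have [y wvy] : exists y, w v y = 1.
  by exists ((w v y')^-1 *: y'); rewrite linearZr_LR /= mulVf.
pose pr z := z - w v z *: y - w z y *: v.
have [/existsP[i pi]|] := boolP [exists i : 'I_(\dim {:L}), pr (vbasis {:L})`_i != 0].
  set z := (vbasis {:L})`_i in pi.
  have wvz : w v (pr z) = 0.
    by rewrite /pr !linearBr !linearZr_LR /= wvy skewxx; ring.
  have wzy : w (pr z) y = 0.
    by rewrite /pr !linearBl !linearZl_LR /= wvy skewxx; ring.
  have [|X [wX _ _]] := darboux_extension wnd wvz; last by exists X.
  move=> a b ab; have := congr1 (w^~ y) ab.
  rewrite linearDl !linearZl_LR linear0l /= wvy wzy mulr1 mulr0 addr0 => a0; split=> //.
  by move: ab; rewrite a0 scale0r add0r => /eqP; rewrite scaler_eq0 (negPf pi) orbF => /eqP.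
rewrite negb_exists => /forallP pr0.
have : ({:L} <= <<[:: v; y]>>)%VS.
  rewrite -(span_basis (vbasisP {:L})); apply/span_subvP => z /(nthP 0)[i].
  rewrite size_tuple => i4 <-; have := pr0 (Ordinal i4); rewrite negbK /pr subr_eq0 subr_eq /= => /eqP ->.
  by rewrite rpredD // rpredZ // memv_span // !inE eqxx ?orbT.
move/dimvS; rewrite dimL => /leq_trans/(_ (dim_span _)).
by [].
Qed.

(* The hypothesis only leaves the four-dimensional trace part of the torsion, and the
   squares of its components occur in the Jacobi identity. *)
Lemma lie_eq0_of_pure_trace :
  (forall x y, w x y = 0 -> w (lie x y) x = 0) -> forall x y : L, lie x y = 0.
Proof.
move=> h; have [X wX] := darboux_exists; have XB := darboux_basis dimL wX.
have tX := torsion_table X.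
move: (torsion X) tX => t tX.
have J := jacobiator_eq0 XB wX tX.
have := form_lie_comb XB wX tX; rewrite /bracket_table /= => fl.
have H a b : a`_0 * b`_1 - a`_1 * b`_0 + a`_2 * b`_3 - a`_3 * b`_2 = 0 ->
    w (lie (comb X a) (comb X b)) (comb X a) = 0.
  by move=> ab; apply: h; rewrite (form_comb XB wX).
have {}H a b ab := etrans (esym (fl a b a)) (H a b ab).
(* Orthogonal pairs of frame vectors give eight zeros; orthogonal pairs of sums and differences then
   give linear relations among the other entries. *)
have h020 : t 0%N 2%N 0%N = 0.
  by have := H [:: 1; 0; 0; 0] [:: 0; 0; 1; 0] ltac:(by rewrite /= ; ring); rewrite /= => E; lra.
have h030 : t 0%N 3%N 0%N = 0.
  by have := H [:: 1; 0; 0; 0] [:: 0; 0; 0; 1] ltac:(by rewrite /= ; ring); rewrite /= => E; lra.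
have h022 : t 0%N 2%N 2%N = 0.
  by have := H [:: 0; 0; 1; 0] [:: 1; 0; 0; 0] ltac:(by rewrite /= ; ring); rewrite /= => E; lra.
have h033 : t 0%N 3%N 3%N = 0.
  by have := H [:: 0; 0; 0; 1] [:: 1; 0; 0; 0] ltac:(by rewrite /= ; ring); rewrite /= => E; lra.
have h121 : t 1%N 2%N 1%N = 0.
  by have := H [:: 0; 1; 0; 0] [:: 0; 0; 1; 0] ltac:(by rewrite /= ; ring); rewrite /= => E; lra.
have h131 : t 1%N 3%N 1%N = 0.
  by have := H [:: 0; 1; 0; 0] [:: 0; 0; 0; 1] ltac:(by rewrite /= ; ring); rewrite /= => E; lra.
have h122 : t 1%N 2%N 2%N = 0.
  by have := H [:: 0; 0; 1; 0] [:: 0; 1; 0; 0] ltac:(by rewrite /= ; ring); rewrite /= => E; lra.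
have h133 : t 1%N 3%N 3%N = 0.
  by have := H [:: 0; 0; 0; 1] [:: 0; 1; 0; 0] ltac:(by rewrite /= ; ring); rewrite /= => E; lra.
have g1 : t 0%N 2%N 1%N + t 1%N 2%N 0%N = 0.
  by have := H [:: 1; 1; 0; 0] [:: 0; 0; 1; 0] ltac:(by rewrite /= ; ring); rewrite /= => E; lra.
have g2 : t 0%N 3%N 1%N + t 1%N 3%N 0%N = 0.
  by have := H [:: 1; 1; 0; 0] [:: 0; 0; 0; 1] ltac:(by rewrite /= ; ring); rewrite /= => E; lra.
have g3 : t 2%N 3%N 0%N - 2 * t 0%N 3%N 2%N = 0.
  by have := H [:: 0; 0; 1; 1] [:: 1; 0; 0; 0] ltac:(by rewrite /= ; ring); rewrite /= => E; lra.
have g4 : t 2%N 3%N 1%N - 2 * t 1%N 3%N 2%N = 0.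
  by have := H [:: 0; 0; 1; 1] [:: 0; 1; 0; 0] ltac:(by rewrite /= ; ring); rewrite /= => E; lra.
have [k1 k2] : t 0%N 1%N 0%N - t 0%N 3%N 2%N - t 2%N 3%N 0%N = 0 /\
  t 0%N 2%N 1%N - 2 * t 1%N 2%N 0%N - t 2%N 3%N 2%N = 0.
  have := H [:: 1; 0; 1; 0] [:: 0; 1; 0; -1] ltac:(by rewrite /= ; ring).
  by have := H [:: 1; 0; -1; 0] [:: 0; -1; 0; -1] ltac:(by rewrite /= ; ring);
    rewrite /= => E E'; split; lra.
have [k3 k4] : t 0%N 1%N 0%N + t 0%N 3%N 2%N - 2 * t 2%N 3%N 0%N = 0 /\
  t 0%N 3%N 1%N - 2 * t 1%N 3%N 0%N - t 2%N 3%N 3%N = 0.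
  have := H [:: 1; 0; 0; 1] [:: 0; 1; 1; 0] ltac:(by rewrite /= ; ring).
  by have := H [:: 1; 0; 0; -1] [:: 0; -1; 1; 0] ltac:(by rewrite /= ; ring);
    rewrite /= => E E'; split; lra.
have k5 : t 0%N 1%N 1%N - t 1%N 3%N 2%N - t 2%N 3%N 1%N = 0.
  have := H [:: 0; 1; 1; 0] [:: 1; 0; 0; 1] ltac:(by rewrite /= ; ring).
  by have := H [:: 0; 1; -1; 0] [:: -1; 0; 0; 1] ltac:(by rewrite /= ; ring); rewrite /= => E E'; lra.
(* The entries t_021, t_031, t_032 and t_132 remain as parameters of the trace part. *)
have s120 : t 1%N 2%N 0%N = - t 0%N 2%N 1%N by lra.
have s130 : t 1%N 3%N 0%N = - t 0%N 3%N 1%N by lra.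
have s230 : t 2%N 3%N 0%N = 2 * t 0%N 3%N 2%N by lra.
have s231 : t 2%N 3%N 1%N = 2 * t 1%N 3%N 2%N by lra.
have s010 : t 0%N 1%N 0%N = 3 * t 0%N 3%N 2%N by lra.
have s011 : t 0%N 1%N 1%N = 3 * t 1%N 3%N 2%N by lra.
have s232 : t 2%N 3%N 2%N = 3 * t 0%N 2%N 1%N by lra.
have s233 : t 2%N 3%N 3%N = 3 * t 0%N 3%N 1%N by lra.
have za : t 0%N 3%N 2%N = 0.
  apply/eqP; rewrite -sqrf_eq0; apply/eqP.
  have := J 0%N 2%N 3%N 0%N isT isT isT isT; rewrite /jacobiator /bracket_table /=.
  by rewrite ?(h020, h030, h022, h033, h121, h131, h122, h133, s010, s011, s120, s130, s230,
    s231, s232, s233); lra.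
have zb : t 1%N 3%N 2%N = 0.
  apply/eqP; rewrite -sqrf_eq0; apply/eqP.
  have := J 1%N 2%N 3%N 1%N isT isT isT isT; rewrite /jacobiator /bracket_table /=.
  by rewrite ?(h020, h030, h022, h033, h121, h131, h122, h133, s010, s011, s120, s130, s230,
    s231, s232, s233); lra.
have zg : t 0%N 2%N 1%N = 0.
  apply/eqP; rewrite -sqrf_eq0; apply/eqP.
  have := J 0%N 1%N 2%N 2%N isT isT isT isT; rewrite /jacobiator /bracket_table /=.
  by rewrite ?(h020, h030, h022, h033, h121, h131, h122, h133, s010, s011, s120, s130, s230,
    s231, s232, s233); lra.
have zd : t 0%N 3%N 1%N = 0.
  apply/eqP; rewrite -sqrf_eq0; apply/eqP.
  have := J 0%N 1%N 3%N 3%N isT isT isT isT; rewrite /jacobiator /bracket_table /=.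
  by rewrite ?(h020, h030, h022, h033, h121, h131, h122, h133, s010, s011, s120, s130, s230,
    s231, s232, s233); lra.
rewrite h020 h030 h022 h033 h121 h131 h122 h133 s010 s011 s120 s130 s230 s231 s232 s233 in tX.
rewrite za zb zg zd !(mulr0, oppr0, subrr) in tX.
have t0 (i j k : 'I_4) : w (lie X`_i X`_j) X`_k = 0.
  rewrite tX /bracket_table.
  by case: i => -[|[|[|[|]]]] // ?; case: j => -[|[|[|[|]]]] // ?;
    case: k => -[|[|[|[|]]]] //= ?; rewrite subrr.
move=> x y; rewrite (darboux_coord XB wX x) (darboux_coord XB wX y).
by rewrite (lie_comb XB wX (t := fun _ _ _ => 0) t0)
  !mulr0 !addr0 oppr0 combE /vec4s /vec4 /= !scale0r !addr0.
Qed.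

End Frames.

(** * Normal frames and the dichotomy *)

Section Dichotomy.
Context {R : realType} {L : lieAlgType R}.
Hypothesis dimL : \dim {:L} = 4%N.

(** Since t_133 = -1, adding multiples of [x] to X_1 and X_2 removes t_131 and t_132; the term
    [- rho *: v] keeps the frame Darboux. The vanishing of t_030 is the hypothesis N(x) = 0. *)
Lemma normal_frame (w : {skew_symmetric L}) x v : is_symplectic_form w ->
  (forall y, w v y = w (lie x y) x) -> w (lie x v) v = 0 ->
  (forall a b, a *: v + b *: x = 0 -> a = 0 /\ b = 0) ->
  exists2 X : 4.-tuple L, darboux w X &
    [/\ torsion w X 0 3 0 = 0, torsion w X 0 3 3 = 0 & torsion w X 2 3 3 = 0] /\
    [/\ torsion w X 1 3 1 = 0, torsion w X 1 3 2 = 0 & torsion w X 1 3 3 = -1].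
Proof.
move=> [wnd wcl] vP Nx indep.
have wvx : w v x = 0 by rewrite vP liexx linear0l.
have [X [[[w01 w23 w02 w03] [w12 w13]] X0 X3]] := darboux_extension wnd wvx indep.
pose rho := torsion w X 1 3 1.
pose sigma := torsion w X 1 3 2 - rho * torsion w X 1 3 0.
have v' y : w (lie y x) x = - w v y by rewrite lieC linearNl vP.
have lx1 : lie (X`_1 + rho *: x) x = lie X`_1 x.
  by rewrite linearDl linearZl_LR /= liexx scaler0 addr0.
have lx133 : torsion w X 1 3 3 = -1 by rewrite /torsion X3 v' -X0 w01.
exists [tuple v; X`_1 + rho *: x; X`_2 - rho *: v + sigma *: x; x].
  rewrite -X0 -X3; split; split=> //=;
    rewrite ?(linearDl, linearBl, linearNl, linearDr, linearBr, linearNr) /=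
      ?(linearZl_LR, linearZr_LR) /= ?(linearZl_LR, linearZr_LR) /= ?skewxx;
    rewrite ?(skewC w X`_1 X`_0) ?(skewC w X`_3 X`_0) ?(skewC w X`_3 X`_2) ?(skewC w X`_3 X`_1);
    rewrite ?w01 ?w23 ?w02 ?w03 ?w12 ?w13; ring.
split; split; rewrite /torsion /=.
- by transitivity (- w (lie x v) v); [rewrite lieC linearNl | rewrite Nx oppr0].
- by rewrite v' skewxx oppr0.
- rewrite v' -X0 -X3 !linearDr linearNr !linearZr_LR /= skewxx w02 w03; ring.
- rewrite lx1 linearDr linearZr_LR /=.
  by rewrite -X3 -/(torsion w X 1 3 1) -/(torsion w X 1 3 3) lx133 /rho; ring.
- rewrite lx1 !linearDr linearNr !linearZr_LR /=.
  rewrite -X0 -X3 -/(torsion w X 1 3 2) -/(torsion w X 1 3 3) -/(torsion w X 1 3 0) lx133 /sigma.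
  by ring.
rewrite lx1 /=.
by rewrite -X3 -/(torsion w X 1 3 3) lx133.
Qed.

Lemma ricci13_or_excluded (w : {skew_symmetric L}) : is_symplectic_form w ->
  ~ admits_ricci13 L -> excluded L.
Proof.
move=> ws ng.
have flat (w' : {skew_symmetric L}) x v : is_symplectic_form w' ->
    (forall y, w' v y = w' (lie x y) x) -> w' (lie x v) v = 0.
  move=> w's vP; apply/eqP/negPn/negP => Nx.
  by apply: ng; exact: (ricci13_of_quintic dimL w's vP Nx).
(* Such a [y] certifies that v_x is not proportional to [x]; if there is none for any [x], the
   algebra is abelian. *)
have [[x [y [wxy Sxy]]]|h] := pselect (exists x y, w x y = 0 /\ w (lie x y) x <> 0); last first.
  have lie0 : forall x y : L, lie x y = 0.
    apply: (lie_eq0_of_pure_trace dimL ws) => x y wxy; apply: contrapT => Sxy.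
    by apply: h; exists x, y.
  have [X wX] := darboux_exists dimL ws.
  by apply: (excluded_of_central dimL (darboux_basis dimL wX)) => z; exact: lie0.
have [v vP] : exists v, forall z, w v z = w (lie x z) x.
  by apply: (riesz ws.1) => a z z'; rewrite linearPr linearDl linearZl_LR.
have indep a b : a *: v + b *: x = 0 -> a = 0 /\ b = 0.
  move=> ab; have := congr1 (w^~ y) ab.
  rewrite linearDl !linearZl_LR linear0l /= wxy mulr0 addr0 vP => /eqP.
  rewrite mulf_eq0 => /orP[/eqP a0|/eqP //]; split=> //.
  move: ab; rewrite a0 scale0r add0r => /eqP; rewrite scaler_eq0 => /orP[/eqP //|/eqP x0].
  by case: Sxy; rewrite x0 !linear0l.
have [X wX [[t030 t033 t233] [t131 t132 t133]]] :=
  normal_frame ws vP (flat _ _ _ ws vP) indep.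
have XB := darboux_basis dimL wX.
have tX := torsion_table ws X; rewrite t030 t033 t233 t131 t132 t133 in tX.
rewrite sub0r in tX.
have c0 a := flat_quintic flat a ws XB wX tX.
have J := jacobiator_eq0 XB wX tX.
case: (flat_normal_form (fun y => c0 _) (fun y => c0 _) J) => [[p p0 e]|[p [u [pu e]]]|[q [r [u e]]]];
  rewrite e in tX.
- by case: ng; exact: (ricci13_of_torsion_hyperbolic dimL XB wX p0 tX).
- by case: ng; exact: (ricci13_of_torsion_r4m1m1 dimL XB wX pu tX).
exact: (excluded_of_torsion_reducible dimL flat XB wX tX).
Qed.

End Dichotomy.

Theorem theoremB (R : realType) (L : lieAlgType R)
    (dimL : \dim {:L} = 4%N)
    (sympL : exists w : {skew_symmetric L}, is_symplectic_form w) :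
  let not_excluded :=
    ~ (lie_isomorphic L (heis3 R * abelian_lie R 1)%type \/
       lie_isomorphic L (aff1 R * abelian_lie R 2)%type \/
       lie_isomorphic L (abelian_lie R 4)) in
  ((exists (g : {dot L for idfun}) (w : {skew_symmetric L}) (J : 'End(L))
           (nabla : {bilinear L -> L -> L}),
      [/\ is_almost_kahler g w J, is_levi_civita g nabla
        & nondegenerate_form (ricci nabla)])
   <-> not_excluded)
  /\
  ((exists (g : {dot L for idfun}) (w : {skew_symmetric L}) (J : 'End(L))
           (nabla : {bilinear L -> L -> L}),
      [/\ is_almost_kahler g w J, is_levi_civita g nabla,
          nondegenerate_form (ricci nabla)
        & has_signature g (ricci nabla) 1 3])
   <-> not_excluded).
Proof.
move=> not_excluded.
(* The obstruction holds for every metric, so it serves both equivalences. *)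
have degenerate (g : {dot L for idfun}) (nabla : {bilinear L -> L -> L}) :
    is_levi_civita g nabla -> nondegenerate_form (ricci nabla) -> not_excluded.
  move=> lc nd iso; apply: (large_center_degenerate _ lc nd).
  case: iso => [h|[h|h]]; apply: (large_center_iso h).
  - exact: heis3_large_center.
  - exact: aff1_large_center.
  exact: abelian_large_center.
(* The prescribed signature is obtained directly, which settles existence in both equivalences. *)
have exist : not_excluded -> admits_ricci13 L.
  case: sympL => w ws ne; apply: contrapT => /(ricci13_or_excluded dimL ws).
  exact: ne.
split; split.
- by case=> g [w [J [nabla [_ lc nd]]]]; exact: degenerate lc nd.
- by case/exist => g [w [J [nabla [ak lc nd _]]]]; exists g, w, J, nabla.
- by case=> g [w [J [nabla [_ lc nd _]]]]; exact: degenerate lc nd.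
exact: exist.
Qed.
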